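(* Consider the setting described in the context and fix $\bar n\in\mathbb{N}$. Suppose that $\inf\phi>-\infty$, $A$ is closed, $f$ is continuous relative to $A$, the random elements $\boldsymbol{\xi}_1,\boldsymbol{\xi}_2,\dots$ are independent and identically distributed as $\boldsymbol{\xi}$, and that: (B$_Z$) For each $\bar z\in A$, $G(\cdot,\bar z)$ is measurable and there are $\rho\in(0,\infty)$ and a $P$-integrable $c:\Xi\to[0,\infty)$ such that $\|G(\xi,z)\|_\infty\le c(\xi)$ for all $z\in A$ with $\|z-\bar z\|_Z\le\rho$ and a.e. $\xi\in\Xi$. Suppose that, for all $n\ge\bar n$, $\inf\phi_n<\infty$ and the following four conditions hold: 1. (Continuity) For a.e. $\xi\in\Xi$ and $i=1,\dots,m$, the mappings $s(\xi,\cdot):Z\to U$, $g_i:U\times Z\to\mathbb{R}$ and $T_n$ are continuous; and for every $z_n\in\mathbb{R}^n$, $G_n(\cdot,z_n):\Xi\to\mathbb{R}^m$ is measurable. 2. (Local boundedness) For each $\bar z_n\in A_n$ there are $\rho\in(0,\infty)$ and a $P$-integrable $c:\Xi\to[0,\infty)$ such that $\|G_n(\xi,z_n)\|_\infty\le c(\xi)$ for all $z_n\in\mathbb{B}(\bar z_n,\rho)\cap A_n$ and a.e. $\xi\in\Xi$. 3. (Approximation of performance functions) There is a sequence $\{\epsilon^\nu\in[0,\infty),\nu\in\mathbb{N}\}$ with $\epsilon^\nu\to0$ such that $|g_i^\nu(u,z)-g_i(u,z)|\le\epsilon^\nu$ for all $u\in U$, $z\in Z^n\cap A$, $i=1,\dots,m$.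 4. (Solution properties and approximations) There exist $\eta,\kappa\in(0,\infty)$, $\lambda,\mu:\Xi\to[0,\infty)$, $\rho,\pi:A_n\to(0,\infty)$ and $\Delta_0,\Delta_\nu:A_n\to[0,\infty)$, $\nu\in\mathbb{N}$, such that: (i) $\mathbb{E}[\lambda^\eta(\boldsymbol{\xi})\mu^\kappa(\boldsymbol{\xi})]$ and $\mathbb{E}[\mu^\kappa(\boldsymbol{\xi})]$ are finite; (ii) for all $z_n\in A_n$, $z^n=T_n(z_n)$, $u,u'\in U$, $\nu\in\mathbb{N}$, $i=1,\dots,m$, and a.e. $\xi\in\Xi$, one has $$|g_i(u,z^n)-g_i(u',z^n)|\le\pi(z_n)\big(\|u\|_U^\eta+\|u'\|_U^\eta+1\big)\|u-u'\|_U^\kappa,$$ $$\max\{\|s(\xi,z^n)\|_U,\|s^\nu(\xi,z^n)\|_U\}\le\lambda(\xi)\Delta_0(z_n),\qquad \|s^\nu(\xi,z^n)-s(\xi,z^n)\|_U\le\mu(\xi)\Delta_\nu(z_n);$$ (iii) for all $\bar z_n\in A_n$, with $B=\mathbb{B}(\bar z_n,\rho(\bar z_n))\cap A_n$, one has $\sup_{z_n\in B}\pi(z_n)<\infty$, $\sup_{z_n\in B}\Delta_0(z_n)<\infty$, and $\sup_{z_n\in B}\Delta_\nu(z_n)\to0$ as $\nu\to\infty$. Moreover, suppose that either (a) or (b) holds: (a) $h$ is continuous and $h^\nu(w^\nu)\to h(w)>-\infty$ whenever $w^\nu\to w\in\mathbb{R}^m$; and for all $z\in A$ there exists $z^n\in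 A\cap Z^n$ with $z^n\to z$ as $n\to\infty$. (b) All of the following hold: - $\liminf_\nu h^\nu(w^\nu)\ge h(w)>-\infty$ whenever $w^\nu\to w\in\mathbb{R}^m$; - $h^\nu(w)\le h(w)$ for all $w\in\mathbb{R}^m$, $\nu\in\mathbb{N}$; - $h$ is lower semicontinuous and $h(w)\le h(w')$ for all $w\le w'$ (componentwise); - for every $n\ge\bar n$ and every $z_n\in A_n$ satisfying $h(\mathbb{E}[G_n(\boldsymbol{\xi},z_n)])<\infty$, there exists $z_n^\nu\in A_n$ with $z_n^\nu\to z_n$ as $\nu\to\infty$ such that $(\mathbb{E}[G_n(\boldsymbol{\xi},z_n^\nu)])_i<(\mathbb{E}[G_n(\boldsymbol{\xi},z_n)])_i$ for all components $i=1,\dots,m$ and all $\nu\in\mathbb{N}$; - for every $z\in A$ with $h(\mathbb{E}[G(\boldsymbol{\xi},z)])<\infty$, there exists $z^n\in A\cap Z^n$ with $z^n\to z$ as $n\to\infty$ such that $\mathbb{E}[G(\boldsymbol{\xi},z^n)]\le\mathbb{E}[G(\boldsymbol{\xi},z)]$ (componentwise) for all $n\in\mathbb{N}$. Then, with probability one (over the sample defining the functions $\phi_n^\nu$), the following holds: for any $\epsilon\in(0,\infty)$ there exists $n_\epsilon\ge\bar n$ such that if $n\ge n_\epsilon$, $\delta^\nu\in[0,\infty)$ with $\delta^\nu\to\delta\in[0,\infty)$, and $\{\bar z_n^\nu\in\delta^\nu\text{-}\operatorname{argmin}\phi_n^\nu,\ \nu\in\mathbb{N}\}$ has a cluster point $\bar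 z_n$, then $$\phi\big(T_n(\bar z_n)\big)\le\inf\phi+\epsilon+\delta .$$ That is, the optimality gap for $\bar z_n$ is $\epsilon+\delta$.
   Context: Setting. $(Z,\|\cdot\|_Z)$ and $(U,\|\cdot\|_U)$ are separable Banach spaces; product spaces carry the product norm. $\boldsymbol{\xi}$ is a measurable function from a probability space $(\Omega,\mathcal{F},\mathbb{P})$ to a Hilbert space $\Xi$ (of functions on a domain $D\subset\mathbb{R}^d$) with Borel $\sigma$-field, inducing the probability space $(\Xi,\mathcal{B},P)$, which is taken to be complete; ''a.e. $\xi$'' refers to $P$. $A\subset Z$ is the admissible set; $f:Z\to\mathbb{R}$; $h:\mathbb{R}^m\to\overline{\mathbb{R}}=[-\infty,\infty]$; $s:\Xi\times Z\to U$ (solution mapping); $g_i:U\times Z\to\mathbb{R}$, $i=1,\dots,m$; $G:\Xi\times Z\to\mathbb{R}^m$, $G(\xi,z)=(g_1(s(\xi,z),z),\dots,g_m(s(\xi,z),z))$. The actual objective function is $$\phi(z)=\iota_A(z)+f(z)+h\big(\mathbb{E}[G(\boldsymbol{\xi},z)]\big),\quad z\in Z,$$ where $\iota_C$ is $0$ on $C$ and $\infty$ off $C$, $\mathbb{E}[G(\boldsymbol{\xi},z)]=\int G(\xi,z)\,dP(\xi)$ is assumed well defined and finite, extended arithmetic has $\infty-\infty=\infty$, and $\phi(z)=\infty$ if $z\notin A$. Discretization. For each $n\in\mathbb{N}$, $Z^n\subset Z$ and $T_n:\mathbb{R}^n\to Z^n$ is surjective. $A_n=\{z_n\in\mathbb{R}^n\mid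 T_n(z_n)\in A\}$, $f_n(z_n)=f(T_n(z_n))$, $G_n(\xi,z_n)=G(\xi,T_n(z_n))$, $\phi_n(z_n)=\phi(T_n(z_n))$. Approximation. For $\nu\in\mathbb{N}$: $h^\nu:\mathbb{R}^m\to\overline{\mathbb{R}}$, $g_i^\nu:U\times Z\to\mathbb{R}$, $s^\nu:\Xi\times Z\to U$ are given functions, $G^\nu(\xi,z)=(g_1^\nu(s^\nu(\xi,z),z),\dots,g_m^\nu(s^\nu(\xi,z),z))$, $G_n^\nu(\xi,z_n)=G^\nu(\xi,T_n(z_n))$. For a realization $\xi_1,\xi_2,\dots$ of the sample $\boldsymbol{\xi}_1,\boldsymbol{\xi}_2,\dots$, $$\phi_n^\nu(z_n)=\iota_{A_n}(z_n)+f_n(z_n)+h^\nu\Big(\frac1\nu\sum_{j=1}^\nu G_n^\nu(\xi_j,z_n)\Big),\quad z_n\in\mathbb{R}^n.$$ $\mathbb{B}(\bar z_n,\rho)=\{z_n\in\mathbb{R}^n\mid\|z_n-\bar z_n\|_2\le\rho\}$. For $g:Y\to\overline{\mathbb{R}}$: $\inf g=\inf_{y\in Y}g(y)$ and $\delta\text{-}\operatorname{argmin} g=\{y\in Y\mid g(y)<\infty,\ g(y)\le\inf g+\delta\}$. *)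

(* Defs.v *)
From HB Require Import structures.
From mathcomp Require Import all_boot all_order all_algebra.
From mathcomp Require Import sesquilinear finmap.
From mathcomp Require Import all_classical all_reals all_analysis.
From mathcomp Require Import measurable_realfun.

Set Implicit Arguments.
Unset Strict Implicit.
Unset Printing Implicit Defensive.

Import Order.TTheory GRing.Theory Num.Theory.
Import numFieldNormedType.Exports.

Local Open Scope classical_set_scope.
Local Open Scope ring_scope.

Definition separable_space (T : topologicalType) : Prop :=
  exists2 D : set T, countable D & dense D.

(* Completeness is part of the type [completeNormedModType R]. *)
Definition is_hilbert (R : realType) (H : completeNormedModType R) : Prop :=
  exists ip : {dot H for idfun}, forall x, `|x| = Num.sqrt (ip x x).

Notation borel T := (g_sigma_algebraType (@open T)).

Section completion.
Local Open Scope ereal_scope.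
Context d (T : measurableType d) (R : realType).

(* T with the sigma-algebra of all A `|` N, A measurable, N mu-negligible. *)
Definition completion_type (mu : set T -> \bar R) :=
  g_sigma_algebraType (completed_algebra_gen mu).

Variable mu : {measure set T -> \bar R}.

(* The outer measure of mu is the unique extension of mu to the completed
   sigma-algebra when mu is finite. *)
Definition completion : set (completion_type mu) -> \bar R := (mu^*)%mu.

Lemma completion_measurable_cara (A : set (completion_type mu)) :
  measurable A -> (mu^*)%mu.-cara.-measurable A.
Proof.
move: A; apply: smallest_sub.
  split; [exact: measurable0|by move=> ? ?; rewrite setTD; exact: measurableC|].
  by move=> F mF; exact: bigcupT_measurable.
move=> _ [B mB] [N [M [mM M0 NM]] <-].
apply: measurableU; first exact: caratheodory_measurable_mu_ext.
apply: (@measure_is_complete_caratheodory _ _ (mu^*)%mu).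
exists M; split => //; first exact: caratheodory_measurable_mu_ext.
by rewrite -M0; exact: measurable_mu_extE.
Qed.

Let completion0 : completion set0 = 0.
Proof. exact: mu_ext0. Qed.

Let completion_ge0 A : 0 <= completion A.
Proof. exact: mu_ext_ge0. Qed.

Let completion_sigma_additive : semi_sigma_additive completion.
Proof.
move=> F mF tF mUF; apply: caratheodory_measure_sigma_additive => //.
  by move=> i; exact: completion_measurable_cara.
exact: completion_measurable_cara.
Qed.

HB.instance Definition _ := isMeasure.Build _ _ _ completion
  completion0 completion_ge0 completion_sigma_additive.

Lemma completionE (A : set T) : measurable A -> completion A = mu A.
Proof. by move=> mA; rewrite /completion measurable_mu_extE. Qed.

End completion.
Arguments completion {d T R} mu _.

Section completion_probability.
Context d (T : measurableType d) (R : realType) (mu : probability T R).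

Let completion_setT : completion mu setT = 1%E.
Proof. exact: etrans (completionE mu measurableT) (probability_setT mu). Qed.

HB.instance Definition _ :=
  Measure_isProbability.Build _ _ _ (completion mu) completion_setT.

End completion_probability.

Section sampling.
Context d d' (Omega : measurableType d) (T : measurableType d') (R : realType).
Variables (Pr : probability Omega R) (X : nat -> {RV Pr >-> T}).

Definition mutually_independent : Prop :=
  forall (J : {fset nat}) (B : nat -> set T), (forall j, measurable (B j)) ->
    Pr (\bigcap_(j in [set` J]) (X j @^-1` B j)) =
    (\prod_(j <- J) Pr (X j @^-1` B j))%E.

Definition identically_distributed_as (X0 : {RV Pr >-> T}) : Prop :=
  forall j (B : set T), measurable B ->
    distribution Pr (X j) B = distribution Pr X0 B.

End sampling.

Definition indicator (R : realType) (Y : Type) (C : set Y) (y : Y) : \bar R :=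
  if `[< C y >] then 0%E else +oo%E.
Arguments indicator {R Y} C y.

Definition delta_argmin (R : realType) (Y : Type) (delta : R)
    (g : Y -> \bar R) : set Y :=
  [set y | (g y < +oo)%E /\ (g y <= ereal_inf (range g) + delta%:E)%E].

(* The library norm on 'rV_n is the sup norm, hence the separate Euclidean one. *)
Definition norm2 (R : realType) n (x : 'rV[R]_n) : R :=
  Num.sqrt (\sum_i x 0 i ^+ 2).

Definition ball2 (R : realType) n (x : 'rV[R]_n) (r : R) : set 'rV[R]_n :=
  [set y | norm2 (y - x) <= r].

Definition lev (R : realType) m (w w' : 'rV[R]_m) : Prop :=
  forall i, w 0 i <= w' 0 i.

Definition ltv (R : realType) m (w w' : 'rV[R]_m) : Prop :=
  forall i, w 0 i < w' 0 i.

Definition performance (R : realType) (Xi U Z : Type) m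
    (g : 'I_m -> U * Z -> R) (s : Xi -> Z -> U) (x : Xi) (z : Z) : 'rV[R]_m :=
  \row_i g i (s x z, z).

Definition expectation_vec d (T : measurableType d) (R : realType)
    (P : {measure set T -> \bar R}) m (F : T -> 'rV[R]_m) : 'rV[R]_m :=
  \row_i (\int[P]_x F x 0 i)%R.

(* Addition is the dual one of [\bar^d R], for which -oo + +oo = +oo. *)
Definition composite_objective (R : realType) (Y : Type) m (C : set Y)
    (f0 : Y -> R) (h : 'rV[R]_m -> \bar R) (w : Y -> 'rV[R]_m) (y : Y) : \bar R :=
  (indicator C y + (f0 y)%:E + h (w y))%dE.

(* Every sequence indexed by n or nu in {1, 2, ...} is indexed here by nat, with
   index k standing for k + 1: the average below has nu + 1 terms, and the
   discretization of index n is parametrized by 'rV_n.+1. *)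
Definition sample_mean (R : realType) (Xi : Type) m (F : Xi -> 'rV[R]_m)
    (x : nat -> Xi) (nu : nat) : 'rV[R]_m :=
  nu.+1%:R^-1 *: \sum_(j < nu.+1) F (x j).

(* Main.v *)
Require Import Defs.
From HB Require Import structures.
From mathcomp Require Import all_boot all_order all_algebra.
From mathcomp Require Import finmap.
From mathcomp Require Import all_classical all_reals all_analysis.
From mathcomp Require Import measurable_realfun ring lra zify.

(** The discretized problem of index n inherits its limiting behaviour from an
    epigraphical argument, and the randomness enters only through a law of large
    numbers that is uniform in the decision variable.

    Probability.  Everything rests on the strong law of large numbers for pairwise
    independent, identically distributed, merely integrable variables
    ([slln]).  The proof is the one of Etemadi: along blocks whose lengths grow
    geometrically, the means of suitably truncated variables have summable
    variances, the truncation is eventually inactive, and monotonicity of the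
    partial sums of a nonnegative variable fills the gaps between the blocks; the
    growth factor is then sent to 1.  The integrands are measurable only for the
    completed law of the random element, so the probability space carrying the
    sample is completed too: the sample remains pairwise independent and
    identically distributed ([completion_pairwise_iid]), and an event that is almost
    sure for the completion is almost sure ([ae_completion]).

    Uniformity.  The space Z is separable and the integrand is continuous in z and
    locally dominated on A.  Every point of A therefore lies in one of countably
    many balls on which the oscillation of the integrand has a small mean; the
    strong law, applied to the oscillations and to the values at the centers of
    these balls, gives a law of large numbers that is locally uniform on A
    ([uniform_lln]).  Dominated convergence gives the continuity of the expectation
    on A ([expectation_continuous]).  Replacing the integrands by their
    approximations costs a term that tends to 0 locally uniformly, because the
    Hoelder-type estimate splits into a deterministic factor tending to 0 and an
    empirical mean that converges ([sample_means_close]).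

    Optimization.  Once the sample means converge locally uniformly on the
    admissible set, a cluster point of near-minimizers is near-optimal
    ([cluster_near_optimal]).  Two facts are used: the values of the approximating
    objectives cannot drop in the limit ([liminf_lower_epi_limit]), and every value
    of the limiting objective is asymptotically attained from above.  The latter
    holds at the same point when the outer functions converge continuously
    ([upper_approximable_cvg]); when they only bound the monotone limit from below,
    it holds at nearby points with strictly smaller expectations
    ([upper_approximable_monotone]), whose sample means eventually lie below the
    target.  Finally, a near-minimizer of the original objective is approached by
    points of the discretized sets ([discretization_upper]), so the infima of the
    discretized objectives exceed the infimum by at most any prescribed tolerance
    from some index on. *)

Set Implicit Arguments.
Unset Strict Implicit.
Unset Printing Implicit Defensive.

Import Order.TTheory GRing.Theory Num.Theory.
Import numFieldNormedType.Exports.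

Local Open Scope classical_set_scope.
Local Open Scope ring_scope.

(** * Blocks of geometric growth *)

Section blocks.
Variable p : nat.

(** An integer version of the powers of 1 + 1/(p+1): consecutive ratios are at
    least that number ([block_growth]) and tend to it ([block_ratio]). *)
Definition block (n : nat) : nat := iter n (fun k => (k + k %/ p.+1).+1) 1%N.

Lemma block_gt0 n : (0 < block n)%N.
Proof. by case: n. Qed.

Lemma block_lt n : (block n < block n.+1)%N.
Proof. by rewrite /= ltnS leq_addr. Qed.

Lemma block_ge n : (n < block n)%N.
Proof. elim: n => // n IH; exact: leq_ltn_trans IH (block_lt n). Qed.

Lemma block_homo : {homo block : m n / (m <= n)%N}.
Proof.
by apply: homo_leq => // [m n k /leq_trans|n]; [exact|exact/ltnW/block_lt].
Qed.

Lemma block_growth n : (block n.+1 <= p.+2 * (block n.+1 - block n))%N.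
Proof.
have := divn_eq (block n) p.+1; have := ltn_pmod (block n) (ltn0Sn p).
rewrite /=; set q := (_ %/ _)%N; set r := (_ %% _)%N => rp ->.
have -> : (((q * p.+1 + r + q).+1 - (q * p.+1 + r)) = q.+1)%N by lia.
nia.
Qed.

Lemma block_ratio n : (p.+1 * block n.+1 <= p.+2 * block n + p.+1)%N.
Proof.
have := divn_eq (block n) p.+1; rewrite /=; set q := (_ %/ _)%N.
set r := (_ %% _)%N => e; nia.
Qed.

Lemma block_between m N : (block N <= m)%N ->
  exists2 n, (N <= n)%N & (block n <= m < block n.+1)%N.
Proof.
move=> Nm.
have ex : exists n, (m < block n)%N by exists m; exact: block_ge.
case: (ex_minnP ex) => -[|n] mn nmin.
  by have := leq_trans (leq_trans mn (block_homo (leq0n N))) Nm; rewrite ltnn.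
exists n.
  rewrite leqNgt; apply/negP => nN.
  by have := leq_trans mn (leq_trans (block_homo nN) Nm); rewrite ltnn.
by rewrite mn andbT leqNgt; apply/negP => /nmin; rewrite ltnn.
Qed.

Variable R : realType.

Lemma block_growthR n :
  (block n.+1)%:R <= p.+2%:R * ((block n.+1)%:R - (block n)%:R) :> R.
Proof. by rewrite -natrB ?(ltnW (block_lt n))// -natrM ler_nat block_growth. Qed.

(** Each term is at most p + 2 times the decrease of the reciprocal of the maximum
    of t and the block length, and these decreases telescope. *)
Lemma sum_block_inv_le (t : R) N : 0 < t ->
  \sum_(n < N | t <= (block n)%:R) (block n)%:R^-1 <= p.+2%:R / t.
Proof.
move=> t0; pose b n : R := (Num.max t (block n)%:R)^-1.
suff : \sum_(n < N | t <= (block n)%:R) (block n)%:R^-1 <= p.+2%:R * (b 0%N - b N).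
  move/le_trans; apply; rewrite ler_wpM2l// (@le_trans _ _ (b 0%N))//.
    by rewrite gerBl /b invr_ge0 le_max (ltW t0).
  by rewrite /b lef_pV2 ?posrE ?lt_max ?t0// le_max lexx.
elim: N => [|N IH]; first by rewrite big_ord0 subrr mulr0.
rewrite big_mkcond big_ord_recr /= -big_mkcond /=.
have -> : p.+2%:R * (b 0 - b N.+1) =
  p.+2%:R * (b 0 - b N) + p.+2%:R * (b N - b N.+1) by ring.
apply: lerD => //.
have k0 n : 0 < (block n)%:R :> R by rewrite ltr0n block_gt0.
have kS : (block N)%:R < (block N.+1)%:R :> R by rewrite ltr_nat block_lt.
case: ifPn => [tN|_]; last first.
  rewrite mulr_ge0// subr_ge0 /b lef_pV2 ?posrE ?lt_max ?t0//.
  by rewrite ge_max !le_max lexx/= (ltW kS) orbT.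
rewrite /b !max_r ?(le_trans tN (ltW kS))//.
have -> : (block N)%:R^-1 - (block N.+1)%:R^-1 =
  ((block N.+1)%:R - (block N)%:R) / (block N.+1)%:R / (block N)%:R :> R.
  by field; rewrite !gt_eqF.
rewrite -[leLHS]mul1r mulrA ler_wpM2r ?invr_ge0 ?ler0n// mulrA.
rewrite ler_pdivlMr// mul1r.
exact: block_growthR.
Qed.

(** Same telescoping argument, with the minimum of t and the block length. *)
Lemma sum_block_le (t : R) N : 0 <= t ->
  \sum_(n < N | (block n)%:R < t) (block n)%:R <= p.+2%:R * t.
Proof.
move=> t0; case: N => [|N]; first by rewrite big_ord0 mulr_ge0.
pose c n : R := Num.min t (block n)%:R.
suff : \sum_(n < N.+1 | (block n)%:R < t) (block n)%:R <= p.+2%:R * c N.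
  by move/le_trans; apply; rewrite ler_wpM2l// /c ge_min lexx.
have kS n : (block n)%:R < (block n.+1)%:R :> R by rewrite ltr_nat block_lt.
elim: N => [|N IH].
  rewrite big_mkcond big_ord1 /=; case: ifPn => [t1|_].
    by rewrite /c min_r ?(ltW t1)// mulr1 ler_nat.
  by rewrite mulr_ge0// /c le_min t0 ler0n.
rewrite big_mkcond big_ord_recr /= -big_mkcond /=.
have -> : p.+2%:R * c N.+1 = p.+2%:R * c N + p.+2%:R * (c N.+1 - c N) by ring.
apply: lerD => //; case: ifPn => [tN|_]; last first.
  rewrite mulr_ge0// subr_ge0 /c le_min !ge_min lexx/= (ltW (kS N)).
  by rewrite orbT.
by rewrite /c !min_r ?(ltW tN) ?(ltW (lt_trans (kS N) tN))// block_growthR.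
Qed.

End blocks.

(** Between two consecutive block ends the mean of a nondecreasing nonnegative
    sequence changes at most by a factor close to the ratio of the block lengths,
    and this ratio is as close to 1 as desired for p large. *)
Lemma cvg_mean_of_blocks (R : realType) (S : nat -> R) (L : R) :
  (forall n, 0 <= S n) -> {homo S : m n / (m <= n)%N >-> m <= n} ->
  (forall p, S (block p n) / (block p n)%:R @[n --> \oo] --> L) ->
  S n.+1 / n.+1%:R @[n --> \oo] --> L.
Proof.
move=> S0 ndS SL; apply/cvgrPdist_le => /= e0 e0gt0.
(* capping the tolerance at 1 keeps the quadratic error terms below linear ones *)
pose e := Num.min e0 1.
have e1 : e <= 1 by rewrite ge_min lexx orbT.
have e00 : e <= e0 by rewrite ge_min lexx.
have egt0 : 0 < e by rewrite lt_min e0gt0 ltr01.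
have L0 : 0 <= L.
  rewrite -(cvg_lim _ (SL 0%N))//; apply: limr_ge (cvgP _ (SL 0%N)) _.
  by apply: nearW => n; rewrite divr_ge0.
(* p is chosen so that the ratio bound 1 + t satisfies t * (L + 1) <= e / 4 *)
pose p := Num.truncn (8 * (L + 1) / e).
have pP : 8 * (L + 1) / e < p.+1%:R by exact: truncnS_gt.
pose t : R := 2 / p.+1%:R.
have t0 : 0 < t by rewrite divr_gt0.
have tle : t * (L + 1) <= e / 4.
  rewrite /t mulrAC ler_pdivrMr//.
  move: pP; rewrite ltr_pdivrMr// => pP; lra.
have t1 : t <= 1.
  have : t * 1 <= t * (L + 1) by rewrite ler_wpM2l ?(ltW t0)// lerDr.
  by rewrite mulr1 => /le_trans; apply; apply: (le_trans tle); lra.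
have /cvgrPdist_le/(_ (e / 4))/(_ _)[|N _ HN] := SL p; first by rewrite divr_gt0.
pose N' := maxn N p.+1.
exists (block p N') => // m /= Nm.
have [n Nn /andP[nm mn]] := block_between (leqW Nm).
have [Nn1 pn] : (N <= n)%N /\ (p.+1 <= n)%N by move: Nn; rewrite geq_max => /andP.
have Hn := HN n Nn1; have HSn := HN n.+1 (leqW Nn1).
have k0 j : 0 < (block p j)%:R :> R by rewrite ltr0n block_gt0.
have ratio : (block p n.+1)%:R <= (1 + t) * (block p n)%:R.
  have := block_ratio p n.
  rewrite -(ler_nat R) natrD !natrM => br.
  have pk : (p.+1%:R : R) <= (block p n)%:R.
    by rewrite ler_nat (leq_trans pn)// ltnW// block_ge.
  rewrite -(ler_pM2l (ltr0Sn R p)) (le_trans br)// mulrA mulrDr mulr1.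
  have -> : p.+1%:R * t = 2 by rewrite /t mulrC divfK.
  rewrite -[p.+2%:R]natr1; move: (p.+1%:R) pk => q pk; lra.
set x := S m.+1 / m.+1%:R.
have up : x <= (L + e / 4) * (1 + t).
  apply: (@le_trans _ _ (S (block p n.+1) / (block p n)%:R)).
    by rewrite ler_pM// ?invr_ge0 ?ndS ?(ltnW mn)// lef_pV2 ?posrE// ler_nat.
  have : S (block p n.+1) / (block p n.+1)%:R <= L + e / 4.
    by move: HSn; rewrite distrC ler_distl => /andP[].
  rewrite ler_pdivrMr// => H1; rewrite ler_pdivrMr// -mulrA.
  by apply: (le_trans H1); apply: ler_wpM2l ratio; lra.
have lo : L - e / 4 <= x * (1 + t).
  apply: (@le_trans _ _ (S (block p n) / (block p n)%:R)).
    by move: Hn; rewrite distrC ler_distl => /andP[].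
  rewrite ler_pdivrMr// -mulrA.
  have -> : S (block p n) = S (block p n) / m.+1%:R * m.+1%:R by rewrite divfK.
  apply: ler_pM; rewrite ?divr_ge0//.
    by rewrite /x ler_pM2r ?invr_gt0// ndS.
  by rewrite (le_trans _ ratio)// ler_nat ltnW.
have Lt0 : 0 <= t * L by rewrite mulr_ge0 // ltW.
rewrite (le_trans _ e00)// ler_norml; apply/andP; split; nra.
Qed.

(** * Pairwise independent and identically distributed samples *)

Lemma bounded_integrable d (T : measurableType d) (R : realType)
    (mu : {measure set T -> \bar R}) (F : T -> R) (C : R) :
  (mu setT < +oo)%E -> measurable_fun setT F ->
  (forall x, `|F x| <= C) -> mu.-integrable setT (EFin \o F).
Proof.
move=> muoo mF FC; apply: measurable_bounded_integrable => //.
exists C; split; first exact: num_real.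
by move=> c Cc x _; exact: le_trans (FC x) (ltW Cc).
Qed.

Lemma probability_lty d (T : measurableType d) (R : realType)
  (P : probability T R) : (P setT < +oo)%E.
Proof. by rewrite probability_setT ltry. Qed.

Section pairwise_iid.
Context d d' (T : measurableType d) (Omega : measurableType d') (R : realType).
Variables (P : probability T R) (Pr : probability Omega R).

Definition pairwise_iid (X : nat -> Omega -> T) : Prop :=
  [/\ forall j, measurable_fun [set: Omega] (X j),
      forall j B, measurable B -> Pr (X j @^-1` B) = P B &
      forall i j B C, i != j -> measurable B -> measurable C ->
        Pr (X i @^-1` B `&` X j @^-1` C) = (P B * P C)%E].

Variables (X : nat -> Omega -> T) (iidX : pairwise_iid X).

Lemma iid_measurable j : measurable_fun [set: Omega] (X j).
Proof. by case: iidX => + _ _; apply. Qed.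

Lemma iid_law j B : measurable B -> Pr (X j @^-1` B) = P B.
Proof. by case: iidX => _ + _; apply. Qed.

Local Open Scope ereal_scope.

Lemma iid_ge0_integral j (F : T -> \bar R) : measurable_fun setT F ->
  (forall x, 0 <= F x) -> \int[Pr]_w F (X j w) = \int[P]_x F x.
Proof.
move=> mF F0.
rewrite -[LHS](ge0_integral_pushforward (iid_measurable j) Pr measurableT)//=.
apply: (eq_measure_integral P) => [|mXj B mB _]; first exact: iid_measurable.
exact: iid_law.
Qed.

Section centered.
Variables (H : T -> R) (M : R).
Hypotheses (mH : measurable_fun setT H) (H_le : forall x, (`|H x| <= M)%R).
Hypothesis H_centered : \int[P]_x (H x)%:E = 0.

Let norm_prod_le (a b : R) : (`|a| <= M -> `|b| <= M -> `|a * b| <= M * M)%R.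
Proof. by move=> aM bM; rewrite normrM ler_pM. Qed.

(** The joint law of two sample points is a product measure, since it agrees with
    one on rectangles; the integral is then computed by Fubini. *)
Lemma iid_orthogonal i j : i != j ->
  \int[Pr]_w (H (X i w) * H (X j w))%:E = 0.
Proof.
move=> ij.
pose XX w := (X i w, X j w).
have mXX : measurable_fun [set: Omega] XX.
  by apply/measurable_fun_pairP; split; exact: iid_measurable.
pose HH (z : T * T) := (H z.1 * H z.2)%R.
have mHH : measurable_fun setT HH.
  by apply: measurable_funM; apply: measurableT_comp.
have HHint : (P \x P).-integrable setT (EFin \o HH).
  apply: (@bounded_integrable _ _ _ _ _ (M * M)%R) => // [|-[x y]].
    rewrite -setXTT /= product_measure1E//; change (P setT * P setT < +oo).
    by rewrite probability_setT mule1 ltry.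
  exact: norm_prod_le.
transitivity (\int[pushforward Pr XX]_z (HH z)%:E).
  rewrite (integral_pushforward mXX)//; first exact/measurable_EFinP.
  apply: (@bounded_integrable _ _ _ _ _ (M * M)%R).
  - exact: probability_lty.
  - exact: (measurableT_comp mHH).
  - by move=> w; exact: norm_prod_le.
transitivity (\int[P \x P]_z (HH z)%:E).
  apply: (eq_measure_integral (P \x P)%E) => /= A mA _; apply/esym.
  pose mXX' : {mfun Omega >-> (T * T)%type} := mfun_Sub (mem_set mXX).
  apply: (@product_measure_unique _ _ _ _ _ P P (distribution Pr mXX')) => //.
  by move=> B C mB mC; case: iidX => _ _ /(_ i j B C ij mB mC).
rewrite -(integral12_prod_meas1 HHint)/=.
apply: integral0_eq => x _; rewrite /fubini_F /HH /=.
under eq_integral do rewrite EFinM.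
rewrite integralZl//; first by rewrite H_centered mule0.
exact: bounded_integrable (probability_lty _) mH H_le.
Qed.

(** The cross terms vanish by orthogonality. *)
Lemma iid_variance k :
  \int[Pr]_w ((\sum_(j < k) H (X j w)) ^+ 2)%:E =
  k%:R%:E * \int[P]_x ((H x) ^+ 2)%:E.
Proof.
have iHH (i j : nat) : Pr.-integrable setT (fun w => (H (X i w) * H (X j w))%:E).
  apply: (@bounded_integrable _ _ _ _ _ (M * M)%R).
  - exact: probability_lty.
  - by apply: measurable_funM; apply: (measurableT_comp mH); exact: iid_measurable.
  - by move=> w; exact: norm_prod_le.
under eq_integral => w _.
  rewrite expr2 big_distrlr /= -sumEFin.
  under eq_bigr do rewrite -sumEFin.
  over.
rewrite /= integral_sum//=; last by move=> i; exact: integrable_sum.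
transitivity (\sum_(i < k) \int[P]_x ((H x) ^+ 2)%:E).
  apply: eq_bigr => i _; rewrite integral_sum//= (bigD1 i)//= big1 ?adde0.
    under eq_integral do rewrite -expr2.
    apply: (@iid_ge0_integral i (fun x => (H x ^+ 2)%:E)) => [|x].
      exact/measurable_EFinP/measurable_funX.
    by rewrite lee_fin sqr_ge0.
  by move=> j ji; rewrite iid_orthogonal// eq_sym.
by rewrite sumr_const card_ord mule_natl.
Qed.

End centered.
End pairwise_iid.

(** The sum of the sequence has a finite integral, hence is finite almost
    everywhere, and the terms of a convergent series tend to 0.  This replaces the
    Chebyshev inequality followed by the Borel-Cantelli lemma. *)
Lemma ae_cvg0_of_summable_integrals d (T : measurableType d) (R : realType)
    (mu : {measure set T -> \bar R}) (E : nat -> T -> R) (C : R) :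
  (forall n, measurable_fun setT (E n)) -> (forall n x, 0 <= E n x) ->
  (forall N, (\sum_(n < N) \int[mu]_x (E n x)%:E <= C%:E)%E) ->
  {ae mu, forall x, E n x @[n --> \oo] --> 0}.
Proof.
move=> mE E0 EC.
have mE' n : measurable_fun setT (fun x => (E n x)%:E) by exact/measurable_EFinP.
have sumC : (\int[mu]_x (\sum_(n <oo) (E n x)%:E) <= C%:E)%E.
  rewrite integral_nneseries//; last by move=> n x _; rewrite lee_fin.
  apply: lime_le.
    apply: is_cvg_nneseries => n _ _.
    by apply: integral_ge0 => x _; rewrite lee_fin.
  by apply: nearW => N; rewrite big_mkord.
have iS : mu.-integrable setT (fun x => \sum_(n <oo) (E n x)%:E)%E.
  apply/integrableP; split.
    by apply: ge0_emeasurable_sum => // n x _ _; rewrite lee_fin.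
  under eq_integral => x _.
    rewrite gee0_abs; last by apply: nneseries_ge0 => n _ _; rewrite lee_fin.
    over.
  by apply: le_lt_trans sumC _; rewrite ltry.
apply: filterS (integrable_ae measurableT iS) => x /(_ I) fS.
have : cvgn (series (E ^~ x)).
  apply: nondecreasing_is_cvgn.
    by apply/nondecreasing_seqP => n; rewrite /series /= big_nat_recr//= lerDl.
  exists (fine (\sum_(n <oo) (E n x)%:E)%E) => _ [n _ <-].
  rewrite -lee_fin fineK// /series /= -sumEFin.
  by apply: nneseries_lim_ge => k _; rewrite lee_fin.
exact: cvg_series_cvg_0.
Qed.

(** * The strong law of large numbers *)

Section etemadi.
Context d d' (T : measurableType d) (Omega : measurableType d') (R : realType).
Variables (P : probability T R) (Pr : probability Omega R).
Variables (X : nat -> Omega -> T) (iidX : pairwise_iid P Pr X).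
Variables (F : T -> R) (F_ge0 : forall x, 0 <= F x).
Hypothesis iF : P.-integrable setT (EFin \o F).
Variable p : nat.

Let mF : measurable_fun setT F.
Proof. exact/measurable_EFinP/(measurable_int P iF). Qed.

Let k (n : nat) : R := (block p n)%:R.

Let k_gt0 n : 0 < k n. Proof. by rewrite ltr0n block_gt0. Qed.

(* On block n the variable is truncated at the length of the block, not at the
   index of each summand: the truncated summands of a block keep a common law. *)
Let Ft n x : R := if F x <= k n then F x else 0.
Let mean n : R := \int[P]_x Ft n x.

Let mle n : measurable [set x | F x <= k n].
Proof.
rewrite -[X in measurable X]setTI.
exact: (measurable_fun_ler mF (measurable_cst (k n)) measurableT
  (_ : measurable [set true])).
Qed.

Let mlt n : measurable [set x | k n < F x].
Proof.
rewrite (_ : [set _ | _] = ~` [set x | F x <= k n]); first exact: measurableC.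
by apply/seteqP; split=> x /=; rewrite ltNge => /negP.
Qed.

Let FtE n : Ft n = (fun x => F x * \1_[set x | F x <= k n] x).
Proof.
apply/funext => x; rewrite /Ft indicE; case: ifPn => h.
  by rewrite mem_set// mulr1.
by rewrite memNset ?mulr0//; exact/negP.
Qed.

Let mFt n : measurable_fun setT (Ft n).
Proof. by rewrite FtE; apply: measurable_funM => //; exact: measurable_indic. Qed.

Let Ft_ge0 n x : 0 <= Ft n x. Proof. by rewrite /Ft; case: ifP. Qed.
Let Ft_leF n x : Ft n x <= F x. Proof. by rewrite /Ft; case: ifP. Qed.
Let Ft_lek n x : Ft n x <= k n.
Proof. by rewrite /Ft; case: ifP => // _; rewrite ltW. Qed.

Let iFt n : P.-integrable setT (EFin \o Ft n).
Proof.
apply: (bounded_integrable (probability_lty P) (mFt n) (C := k n)) => x.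
by rewrite ger0_norm.
Qed.

Let iFt2 n : P.-integrable setT (EFin \o (fun x => Ft n x ^+ 2)).
Proof.
apply: (bounded_integrable (probability_lty P) _ (C := k n ^+ 2)) => [|x].
  exact: measurable_funX.
by rewrite ger0_norm ?sqr_ge0// ler_sqr ?nnegrE ?(ltW (k_gt0 _))// Ft_lek.
Qed.

Let mean_ge0 n : 0 <= mean n.
Proof. by apply: Rintegral_ge0 => x _. Qed.

Let cvg_mean : mean n @[n --> \oo] --> \int[P]_x F x.
Proof.
apply: fine_cvg; rewrite fineK; last exact: integrable_fin_num.
apply: (dominated_cvg measurableT _ _ _ iF) => //.
- by move=> n; exact/measurable_EFinP.
- move=> x _; apply: cvg_near_cst; exists (Num.truncn (F x)) => // n /= tn.
  rewrite /Ft ifT// (le_trans (ltW (truncnS_gt _)))// ler_nat.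
  by rewrite (leq_trans _ (block_ge p n)).
- by move=> n x _; rewrite /= lee_fin ger0_norm.
Qed.

(* F^2 * \sum_(n | F <= k n) (k n)^-1 is at most a multiple of F. *)
Let sum_square_le N :
  (\sum_(n < N) (k n)^-1%:E * \int[P]_x (Ft n x ^+ 2)%:E <=
   (p.+2%:R * \int[P]_x F x)%:E)%E.
Proof.
rewrite EFinM fineK; last exact: integrable_fin_num.
rewrite -integralZl//.
under eq_bigr => n _ do rewrite -(integralZl measurableT (iFt2 n)).
rewrite -integral_sum//; last by move=> n; exact: integrableZl (iFt2 n).
apply: ge0_le_integral => //.
- move=> x _; apply: sume_ge0 => n _.
  by rewrite -EFinM lee_fin mulr_ge0 ?sqr_ge0// invr_ge0 ltW.
- apply: emeasurable_sum => n; apply/measurable_EFinP.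
  by apply: measurable_funM => //; exact: measurable_funX.
- by apply/measurable_EFinP; exact: measurable_funM.
move=> x _; rewrite /= -EFinM.
under eq_bigr do rewrite -EFinM.
rewrite sumEFin lee_fin.
have := F_ge0 x; rewrite le_eqVlt => /predU1P[F0|Fpos].
  by rewrite -F0 mulr0 big1// => n _; rewrite /Ft -F0 if_same expr0n mulr0.
apply: (@le_trans _ _ (F x ^+ 2 * (p.+2%:R / F x))); last first.
  by rewrite expr2 mulrACA mulrC !mulrA mulfV ?gt_eqF// mul1r mulrC.
apply: le_trans (ler_wpM2l (sqr_ge0 (F x)) (sum_block_inv_le p N Fpos)).
rewrite mulr_sumr [leRHS]big_mkcond /=; apply: ler_sum => n _; rewrite /Ft.
by case: ifPn => _; rewrite ?expr0n ?mulr0// mulrC.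
Qed.

(* \sum_(n | k n < F) k n is at most a multiple of F. *)
Let sum_tail_le N :
  (\sum_(n < N) (k n)%:E * P [set x | k n < F x]%R <=
   (p.+2%:R * \int[P]_x F x)%:E)%E.
Proof.
rewrite EFinM fineK; last exact: integrable_fin_num.
rewrite -integralZl//.
have iI n : P.-integrable setT (EFin \o \1_[set x | k n < F x]).
  by apply: integrable_indic => //; rewrite ltey_eq fin_num_measure.
have PE n : ((k n)%:E * P [set x | k n < F x]%R)%E =
    (\int[P]_x ((k n)%:E * (EFin \o \1_[set x | k n < F x]%R) x))%E.
  by rewrite integralZl// integral_indic// setIT.
under eq_bigr do rewrite PE.
rewrite -integral_sum//; last by move=> n; exact: integrableZl (iI n).
apply: ge0_le_integral => //.
- by move=> x _; apply: sume_ge0 => n _; rewrite mule_ge0// ?lee_fin// ltW.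
- by apply: emeasurable_sum => n; apply/measurable_EFinP; exact: measurable_funM.
- by apply/measurable_EFinP; exact: measurable_funM.
move=> x _; rewrite /= -EFinM.
under eq_bigr do rewrite -EFinM.
rewrite sumEFin lee_fin.
apply: le_trans (sum_block_le p N (F_ge0 x)).
rewrite [leRHS]big_mkcond /=; apply: ler_sum => n _; rewrite indicE.
case: ifPn => h; first by rewrite mem_set// mulr1.
by rewrite memNset ?mulr0//; exact/negP.
Qed.

Let H n x := Ft n x - mean n.

Let mH n : measurable_fun setT (H n).
Proof. exact: measurable_funB. Qed.

Let H_le n x : `|H n x| <= k n + mean n.
Proof.
rewrite (le_trans (ler_normB _ _))// !ger0_norm//.
by rewrite lerD2r.
Qed.

Let H_centered n : (\int[P]_x (H n x)%:E = 0)%E.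
Proof.
under eq_integral do rewrite /H EFinB.
rewrite integralB ?(iFt n)//; last exact: finite_measure_integrable_cst.
have -> : (\int[P]__ (mean n)%:E = (mean n)%:E)%E.
  rewrite -[LHS]/(\int[P]_x (cst (mean n)%:E) x)%E integral_cst//.
  by rewrite -[RHS]mule1; congr (_ * _)%E; exact: probability_setT.
by rewrite /mean /Rintegral fineK ?subee ?(integrable_fin_num _ (iFt n)).
Qed.

(* Adding 2 * mean * H, whose integral is 0, turns H^2 into Ft^2 - mean^2. *)
Let H_square_le n : (\int[P]_x (H n x ^+ 2)%:E <= \int[P]_x (Ft n x ^+ 2)%:E)%E.
Proof.
have iH : P.-integrable setT (EFin \o H n).
  exact: bounded_integrable (probability_lty P) (mH n) (H_le n).
have i1 : P.-integrable setT (fun x => (2 * mean n)%:E * (EFin \o H n) x)%E.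
  exact: integrableZl.
have iH2 : P.-integrable setT (fun x => (H n x ^+ 2)%:E).
  apply: (bounded_integrable (probability_lty P) _ (C := (k n + mean n) ^+ 2)).
    exact: measurable_funX.
  move=> x; rewrite normrX ler_sqr ?nnegrE ?normr_ge0//.
  by rewrite addr_ge0// ltW.
rewrite -[leLHS]adde0 -(mule0 (2 * mean n)%:E) -(H_centered n) -integralZl//.
rewrite -integralD//; apply: le_integral => //; [exact: integrableD|exact: iFt2|].
move=> x _; rewrite /= -EFinM -EFinD lee_fin /H.
have := sqr_ge0 (mean n); nra.
Qed.

(* dev is the squared deviation of the truncated mean of block n, and bad counts
   the sample points of block n that are affected by the truncation. *)
Let dev n w := ((k n)^-1 * \sum_(j < block p n) H n (X j w)) ^+ 2.
Let bad n w : R := \sum_(j < block p n) \1_[set x | k n < F x] (X j w).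

Let mH_X n (j : nat) : measurable_fun [set: Omega] (fun w => H n (X j w)).
Proof. exact: measurableT_comp (mH n) (iid_measurable iidX j). Qed.

Let dev_cvg0 : {ae Pr, forall w, dev n w @[n --> \oo] --> 0}.
Proof.
apply: (@ae_cvg0_of_summable_integrals _ _ _ _ _ (p.+2%:R * \int[P]_x F x)).
- move=> n; apply: measurable_funX; apply: measurable_funM => //.
  by apply: measurable_sum => j; exact: mH_X.
- by move=> n w; exact: sqr_ge0.
move=> N; apply: le_trans (sum_square_le N); apply: lee_sum => n _.
under eq_integral do rewrite /dev exprMn EFinM.
rewrite integralZl//; last first.
  apply: (bounded_integrable (probability_lty Pr) _
    (C := (k n * (k n + mean n)) ^+ 2)).
    by apply: measurable_funX; apply: measurable_sum => j; exact: mH_X.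
  move=> w; rewrite normrX ler_sqr ?nnegrE ?normr_ge0//; last first.
    by rewrite mulr_ge0 ?addr_ge0 ?(ltW (k_gt0 _)).
  rewrite (le_trans (ler_norm_sum _ _ _))//.
  rewrite -[leRHS](_ : \sum_(j < block p n) (k n + mean n) = _).
    by apply: ler_sum => j _; exact: H_le.
  by rewrite sumr_const card_ord -mulr_natl.
rewrite (iid_variance iidX (mH n) (H_le n) (H_centered n)).
rewrite muleA -EFinM expr2 -mulrA mulVf ?gt_eqF// mulr1.
by apply: lee_wpmul2l => //; rewrite lee_fin invr_ge0 ltW.
Qed.

Let bad_cvg0 : {ae Pr, forall w, bad n w @[n --> \oo] --> 0}.
Proof.
have mind n (j : nat) :
    measurable_fun [set: Omega] (fun w => \1_[set x | k n < F x] (X j w) : R).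
  have mI : measurable_fun setT (\1_[set x | k n < F x] : T -> R).
    exact: measurable_indic.
  exact: measurableT_comp mI (iid_measurable iidX j).
apply: (@ae_cvg0_of_summable_integrals _ _ _ _ _ (p.+2%:R * \int[P]_x F x)).
- by move=> n; apply: measurable_sum => j; exact: mind.
- by move=> n w; apply: sumr_ge0.
move=> N; apply: le_trans (sum_tail_le N); apply: lee_sum => n _.
under eq_integral do rewrite /bad -sumEFin.
rewrite ge0_integral_sum//; last first.
  by move=> j; apply/measurable_EFinP; exact: mind.
have PX (j : nat) : (\int[Pr]_w (\1_[set x | k n < F x]%R (X j w))%:E)%E =
    P [set x | k n < F x].
  rewrite (iid_ge0_integral iidX j (F := fun x => (\1_[set x | k n < F x] x)%:E)).
  - by rewrite integral_indic// setIT.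
  - by apply/measurable_EFinP; exact: measurable_indic.
  - by move=> x; rewrite lee_fin.
under eq_bigr => j _.
  rewrite PX; over.
by rewrite sumr_const card_ord mule_natl.
Qed.

Lemma etemadi_blocks : {ae Pr, forall w,
  (\sum_(j < block p n) F (X j w)) / (block p n)%:R @[n --> \oo]
    --> \int[P]_x F x}.
Proof.
apply: filterS2 dev_cvg0 bad_cvg0 => w dw bw.
have avg0 : (k n)^-1 * (\sum_(j < block p n) H n (X j w)) @[n --> \oo] --> 0.
  apply/norm_cvg0P; have : Num.sqrt (dev n w) @[n --> \oo] --> Num.sqrt 0.
    by apply: continuous_cvg => //; exact: sqrt_continuous.
  by rewrite sqrtr0; under eq_fun do rewrite sqrtr_sqr.
rewrite -[X in _ --> X]add0r.
apply: cvg_trans (cvgD avg0 cvg_mean); apply: near_eq_cvg.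
have /cvgrPdist_lt/(_ 1 ltr01) := bw; apply: filterS => n /=.
rewrite sub0r normrN => b1.
(* a nonnegative integer below 1 is 0 *)
have good (j : 'I_(block p n)) : F (X j w) <= k n.
  rewrite leNgt; apply/negP => Fk.
  move: b1; rewrite ger0_norm ?sumr_ge0// ltNge => /negP; apply.
  by rewrite /bad (bigD1 j)//= indicE mem_set// lerDl sumr_ge0.
have -> : \sum_(j < block p n) F (X j w) =
    \sum_(j < block p n) (H n (X j w) + mean n).
  by apply: eq_bigr => j _; rewrite /H subrK /Ft good.
rewrite big_split /= sumr_const card_ord -[mean n *+ _]mulr_natl mulrDl.
by rewrite /= [in RHS]mulrC -/(k n) mulrAC divff ?mul1r// gt_eqF// k_gt0.
Qed.

End etemadi.

Section slln.
Context d d' (T : measurableType d) (Omega : measurableType d') (R : realType).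
Variables (P : probability T R) (Pr : probability Omega R).
Variables (X : nat -> Omega -> T) (iidX : pairwise_iid P Pr X).

Lemma slln_ge0 (F : T -> R) : (forall x, 0 <= F x) ->
  P.-integrable setT (EFin \o F) ->
  {ae Pr, forall w,
    (\sum_(j < n.+1) F (X j w)) / n.+1%:R @[n --> \oo] --> \int[P]_x F x}.
Proof.
move=> F0 iF; have := ae_foralln (etemadi_blocks iidX F0 iF).
apply: filterS => w Sw.
apply: (@cvg_mean_of_blocks R (fun n => \sum_(j < n) F (X j w))) => //.
- by move=> n; exact: sumr_ge0.
- move=> m n mn; rewrite -(subnKC mn) big_split_ord /= lerDl; exact: sumr_ge0.
Qed.

(** The positive and negative parts are functions of the same sample points, so
    they are again averages over an iid sample and [slln_ge0] applies to both. *)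
Lemma slln (F : T -> R) : P.-integrable setT (EFin \o F) ->
  {ae Pr, forall w,
    (\sum_(j < n.+1) F (X j w)) / n.+1%:R @[n --> \oo] --> \int[P]_x F x}.
Proof.
move=> iF.
have iFp := integrable_funrpos measurableT iF.
have iFn := integrable_funrneg measurableT iF.
have FE : F = (fun x => F^\+ x - F^\- x).
  by rewrite -[LHS]funrposBneg.
apply: filterS2 (slln_ge0 (funrpos_ge0 F) iFp) (slln_ge0 (funrneg_ge0 F) iFn).
move=> w cp cn.
rewrite [X in _ --> X](_ : _ = \int[P]_x F^\+ x - \int[P]_x F^\- x).
  apply: cvg_trans (cvgB cp cn); apply: near_eq_cvg; apply: nearW => n /=.
  rewrite -[LHS]mulrBl -sumrB; congr (_ / _); apply: eq_bigr => j _.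
  by rewrite [RHS](congr1 (fun f => f (X j w)) FE).
by rewrite -RintegralB//; congr Rintegral; exact: FE.
Qed.

End slln.

(** * Samples under completed laws *)

Section completion.
Context d (T : measurableType d) (R : realType) (mu : {measure set T -> \bar R}).
Local Open Scope ereal_scope.

Definition agree_off (M A B : set T) := forall x, ~ M x -> A x <-> B x.

Lemma completion_null (M : set T) : measurable M -> mu M = 0 -> completion mu M = 0.
Proof. by move=> mM M0; rewrite completionE. Qed.

Lemma completionU2 (A B : set T) :
  completion mu (A `|` B) <= completion mu A + completion mu B.
Proof. exact: outer_measureU2. Qed.

(** With [completion_split], this reduces every statement about completed sets to
    the measurable sets of the original space. *)
Lemma completion_agree (A B M : set T) : measurable B -> measurable M ->
  mu M = 0 -> agree_off M A B ->
  measurable (A : set (completion_type mu)) /\ completion mu A = mu B.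
Proof.
move=> mB mM M0 AB; split.
  apply: sub_gen_smallest; exists (B `\` M); first exact: measurableD.
  exists (A `&` M).
    by exists M; split => // x [].
  apply/seteqP; split => x.
    by move=> [[Bx Mx]|[]//]; apply/(AB _ Mx).
  move=> Ax; have [Mx|Mx] := pselect (M x); first by right.
  by left; split => //; apply/(AB _ Mx).
have AM0 : completion mu A <= mu B.
  rewrite -(completionE mu mB).
  apply: (@le_trans _ _ (completion mu (B `|` M))).
    apply: le_mu_ext => x Ax; have [Mx|Mx] := pselect (M x); first by right.
    by left; apply/(AB _ Mx).
  apply: le_trans (completionU2 _ _) _.
  by rewrite (completion_null mM M0) adde0.
apply/eqP; rewrite eq_le AM0/= -(completionE mu mB).
apply: (@le_trans _ _ (completion mu (A `|` M))).
  apply: le_mu_ext => x Bx; have [Mx|Mx] := pselect (M x); first by right.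
  by left; apply/(AB _ Mx).
apply: le_trans (completionU2 _ _) _.
by rewrite (completion_null mM M0) adde0.
Qed.

(** The sets that agree with a measurable set off a measurable null set form a
    sigma-algebra containing the generators of the completed one. *)
Lemma completion_split (A : set (completion_type mu)) : measurable A ->
  exists B M : set T, [/\ measurable B, measurable M, mu M = 0 & agree_off M A B].
Proof.
move: A; apply: smallest_sub; last first.
  move=> _ [B mB [N [M [mM M0 NM]]]] <-; exists B, M; split => // x Mx.
  by split => [[//|/NM]|]; [|left].
split.
- by exists set0, set0; split.
- move=> A [B [M [mB mM M0 AB]]]; exists (~` B), M; split => //.
    exact: measurableC.
  by move=> x /AB AxB; rewrite setTD /setC /= AxB.
- move=> F /choice[B] /choice[M] BM; exists (\bigcup_i B i), (\bigcup_i M i).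
  have mB i : measurable (B i) by case: (BM i).
  have mM i : measurable (M i) by case: (BM i).
  split; [exact: bigcup_measurable|exact: bigcup_measurable| |].
    apply/negligibleP; first exact: bigcup_measurable.
    by apply: negligible_bigcup => i; apply/negligibleP => //; case: (BM i).
  move=> x Mx; have agree i : F i x <-> B i x.
    by case: (BM i) => _ _ _; apply=> Mix; apply: Mx; exists i.
  by split => -[i _ /agree]; exists i.
Qed.

(** A null set of the completion differs from a measurable null set by a null set. *)
Lemma ae_completion (Q : T -> Prop) :
  {ae completion mu, forall x, Q x} -> {ae mu, forall x, Q x}.
Proof.
move=> [N [mN N0 QN]].
have [B [M [mB mM M0 NB]]] := completion_split mN.
have [_ NE] := completion_agree mB mM M0 NB.
exists (B `|` M); split; first exact: measurableU.
  by rewrite measureU0// -NE; exact: N0.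
move=> x /QN Nx; have [Mx|Mx] := pselect (M x); first by right.
by left; apply/(NB _ Mx).
Qed.

End completion.

Section completion_iid.
Context d d' (Omega : measurableType d) (T : measurableType d') (R : realType).
Variables (Pr : probability Omega R).
Local Open Scope ereal_scope.

(** Preimages of null sets under the sample points are null because all sample
    points have the law of X0; hence a completed set and its measurable version can
    be exchanged on both sides. *)
Lemma completion_pairwise_iid (X : nat -> {RV Pr >-> T}) (X0 : {RV Pr >-> T}) :
  mutually_independent X -> identically_distributed_as X X0 ->
  @pairwise_iid _ _ (completion_type (distribution Pr X0)) (completion_type Pr)
    R (completion (distribution Pr X0)) (completion Pr) X.
Proof.
move=> indX idX; set D := distribution Pr X0.
have lawX j B : measurable B -> Pr (X j @^-1` B) = D B by move=> mB; exact: idX.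
have mX j B : measurable B -> measurable (X j @^-1` B).
  by move=> mB; rewrite -[X in measurable X]setTI; exact: measurable_funP.
have null j M : measurable M -> D M = 0 -> Pr (X j @^-1` M) = 0.
  by move=> mM M0; rewrite lawX.
have agree j (M A B : set T) : agree_off M A B ->
    agree_off (X j @^-1` M) (X j @^-1` A) (X j @^-1` B).
  by move=> AB w /AB.
split.
- move=> j _ A mA; rewrite setTI.
  have [B [M [mB mM M0 AB]]] := completion_split mA.
  have [+ _] := completion_agree (mX j _ mB) (mX j _ mM) (null _ _ mM M0)
    (agree j _ _ _ AB).
  exact.
- move=> j A mA; have [B [M [mB mM M0 AB]]] := completion_split mA.
  have [_ e] := completion_agree (mX j _ mB) (mX j _ mM) (null _ _ mM M0)
    (agree j _ _ _ AB).
  have [_ e'] := completion_agree mB mM M0 AB.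
  apply: etrans e _; apply: etrans (esym e'); exact: lawX.
move=> i j A A' ij mA mA'.
have [B [M [mB mM M0 AB]]] := completion_split mA.
have [B' [M' [mB' mM' M0' AB']]] := completion_split mA'.
have [_ e1] := completion_agree mB mM M0 AB.
have [_ e2] := completion_agree mB' mM' M0' AB'.
apply: etrans (esym (congr2 (fun x y => x * y) e1 e2)).
have [||||_ e3] := @completion_agree _ _ _ Pr (X i @^-1` A `&` X j @^-1` A')
  (X i @^-1` B `&` X j @^-1` B') (X i @^-1` M `|` X j @^-1` M').
- by apply: measurableI; exact: mX.
- by apply: measurableU; exact: mX.
- by rewrite measureU0; [exact: null|exact: mX|exact: mX|exact: null].
- move=> w /not_orP[/(agree i _ _ _ AB) h /(agree j _ _ _ AB') h'].
  by split => -[/h ? /h' ?].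
apply: etrans e3 _.
(* the product rule for the pair is the one of the finite index set {i, j} *)
have := indX [fset i; j]%fset (fun k => if k == i then B else B').
rewrite big_fsetU1 ?inE//= big_seq_fset1 eqxx eq_sym (negbTE ij).
rewrite !lawX// => <-; last by move=> k; case: ifP.
congr (Pr _); apply/seteqP; split => w /=.
  move=> [Bw B'w] k /=; rewrite !inE => /orP[|] /eqP ->; first by rewrite eqxx.
  by rewrite eq_sym (negbTE ij).
move=> h; split; first by have := h i; rewrite /= !inE eqxx; apply.
by have := h j; rewrite /= !inE eqxx orbT eq_sym (negbTE ij); apply.
Qed.

End completion_iid.

Lemma ae_iid d d' (T : measurableType d) (Omega : measurableType d')
    (R : realType) (P : probability T R) (Pr : probability Omega R)
    (X : nat -> Omega -> T) (Q : T -> Prop) :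
  pairwise_iid P Pr X -> {ae P, forall x, Q x} ->
  {ae Pr, forall w, forall j, Q (X j w)}.
Proof.
move=> iidX [N [mN N0 QN]]; apply: ae_foralln => j.
exists (X j @^-1` N); split.
- by rewrite -[X in measurable X]setTI; exact: (iid_measurable iidX j).
- exact: etrans (iid_law iidX j mN) N0.
- by move=> w; exact: QN.
Qed.

(** * The uniform law of large numbers *)

Lemma dense_sequence (R : realType) (Z : normedModType R) :
  separable_space Z ->
  exists q : nat -> Z, forall z (r : R), 0 < r -> exists n, `|q n - z| < r.
Proof.
move=> [D cD dD].
have meet z (r : R) : 0 < r -> exists2 y, D y & `|y - z| < r.
  move=> r0; have [||y [zy Dy]] := dD (ball z r).
  - by exists z; exact: ballxx.
  - exact: ball_open.
  by exists y => //; rewrite distrC; move: zy; rewrite -ball_normE.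
move/pfcard_geP : cD => [D0|[q]].
  by have [y] := meet 0 1 ltr01; rewrite D0.
exists q => z r r0; have [y Dy yz] := meet z r r0.
have [n _ qn] := surj (f := q) Dy.
by exists n; rewrite qn.
Qed.

(** A subset of a separable metric space is separable: pick a point of the subset
    in every ball of a countable base that meets it. *)
Lemma dense_sequence_in (R : realType) (Z : normedModType R) (S : set Z) :
  separable_space Z -> S !=set0 ->
  exists p : nat -> Z, (forall n, S (p n)) /\
    forall z, S z -> forall r : R, 0 < r -> exists n, `|p n - z| < r.
Proof.
move=> /dense_sequence[q qd] [s0 Ss0].
have pick (k : nat * nat) : exists y, S y /\
    forall z, S z -> `|q k.1 - z| < k.2.+1%:R^-1 -> `|q k.1 - y| < k.2.+1%:R^-1.
  have [[y [Sy yq]]|nex] := pselect (exists y, S y /\ `|q k.1 - y| < k.2.+1%:R^-1).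
    by exists y.
  by exists s0; split => // z Sz zq; exfalso; apply: nex; exists z.
have [y yP] := choice pick.
exists (fun n => if @choice.unpickle (nat * nat)%type n is Some k then y k else s0).
split.
  by move=> n; case: choice.unpickle => [k|//]; case: (yP k).
move=> z Sz r r0.
have [b br] : exists b : nat, b.+1%:R^-1 < r / 2.
  have [b _ /(_ b (leqnn b))] :=
    near_infty_natSinv_lt (PosNum (divr_gt0 r0 (@ltr0Sn R 1))).
  by exists b.
have [a az] := qd z (b.+1%:R^-1) ltac:(by rewrite invr_gt0).
exists (choice.pickle (a, b)); rewrite choice.pickleK.
have [_ /(_ z Sz az) ay] := yP (a, b).
rewrite (splitr r) (le_lt_trans (ler_distD (q a) _ _))// ltrD//.
  by rewrite distrC (lt_trans ay).
by rewrite (lt_trans az).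
Qed.

Section oscillation.
Context d (T : measurableType d) (R : realType) (Z : normedModType R).
Variables (H : T -> Z -> R) (p : nat -> Z).
Local Open Scope ereal_scope.

(** The oscillation of H x around p 0, as a supremum over a sequence so that it is
    measurable in x; [osc_sup] shows that a dense sequence captures it. *)
Definition osc (x : T) : \bar R :=
  esups (fun j => `|H x (p j) - H x (p 0%N)|%:E) 0%N.

Lemma osc_ge j x : `|H x (p j) - H x (p 0%N)|%:E <= osc x.
Proof. by apply: ereal_sup_ubound; exists j. Qed.

Lemma osc_le (M : \bar R) x :
  (forall j, `|H x (p j) - H x (p 0%N)|%:E <= M) -> osc x <= M.
Proof. by move=> HM; apply: ge_ereal_sup => _ [j _ <-]. Qed.

Lemma osc_ge0 x : 0 <= osc x.
Proof. by apply: le_trans (osc_ge 0 x); rewrite lee_fin. Qed.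

Lemma measurable_osc : (forall j, measurable_fun setT (H ^~ (p j))) ->
  measurable_fun setT osc.
Proof.
move=> mH; apply: measurable_fun_esups => j; apply/measurable_EFinP.
by apply: measurableT_comp => //; exact: measurable_funB.
Qed.

Lemma osc_sup (S : set Z) x z :
  (forall z, S z -> forall r : R, (0 < r)%R -> exists n, (`|p n - z| < r)%R) ->
  continuous (H x) -> S z -> `|H x z - H x (p 0%N)|%:E <= osc x.
Proof.
move=> pd cH Sz; apply/lee_addgt0Pr => e e0.
have /cvgrPdist_lt/(_ e e0)/nbhs_ballP[r /= r0 rH] := cH z.
have [n pn] := pd _ Sz _ r0.
have hn : (`|H x z - H x (p n)| < e)%R.
  by apply: rH; rewrite -ball_normE /= distrC.
rewrite (le_trans _ (leeD2r _ (osc_ge n x)))// -EFinD lee_fin.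
by rewrite (le_trans (ler_distD (H x (p n)) _ _))// addrC lerD2l ltW.
Qed.

End oscillation.

Section uniform_lln.
Context d d' (T : measurableType d) (Omega : measurableType d') (R : realType).
Variables (P : probability T R) (Pr : probability Omega R).
Variables (X : nat -> Omega -> T) (iidX : pairwise_iid P Pr X).
Variables (Z : normedModType R) (sepZ : separable_space Z) (A : set Z).
Variable H : T -> Z -> R.
Hypothesis iH : forall z, A z -> P.-integrable setT (EFin \o H ^~ z).
Hypothesis cH : {ae P, forall x, continuous (H x)}.
Hypothesis domH : forall z, A z -> exists (r : R) (c : T -> R),
  [/\ 0 < r, P.-integrable setT (EFin \o c) &
    {ae P, forall x, forall z', A z' -> `|z' - z| <= r -> `|H x z'| <= c x}].

Let mH z : A z -> measurable_fun setT (H ^~ z).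
Proof. by move=> /iH/measurable_int/measurable_EFinP. Qed.

Lemma expectation_continuous z (u : nat -> Z) : A z -> (forall n, A (u n)) ->
  u @ \oo --> z -> \int[P]_x H x (u n) @[n --> \oo] --> \int[P]_x H x z.
Proof.
move=> Az Au uz; have [r [c [r0 ic Hc]]] := domH Az.
have /cvgrPdist_le/(_ r r0)[N _ HN] := uz.
have uNz : u (n + N)%N @[n --> \oo] --> z.
  by rewrite (cvg_shiftn N (fun n => u n)).
rewrite -(cvg_shiftn N (fun n => \int[P]_x H x (u n))) /=.
apply: fine_cvg; rewrite fineK; last by apply: integrable_fin_num => //; exact: iH.
have [] // := @dominated_convergence _ _ _ P setT measurableT
  (fun n x => (H x (u (n + N)%N))%:E) (fun x => (H x z)%:E) (fun x => (c x)%:E).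
- by move=> n; apply/measurable_EFinP; exact: mH.
- by apply/measurable_EFinP; exact: mH.
- apply: filterS cH => x cHx _; apply: cvg_EFin.
    exact: nearW.
  exact: (cvg_comp _ _ uNz (cHx z)).
- apply: filterS Hc => x Hcx n _ /=; rewrite lee_fin; apply: Hcx => //.
  by rewrite distrC; apply: HN; rewrite /= leq_addl.
Qed.

(* V q k is a countable base of open balls when q has dense range. *)
Let V (q : nat -> Z) (k : nat * nat) : set Z :=
  [set z | `|q k.1 - z| < k.2.+1%:R^-1].

(** Shrink the ball around z: the oscillation tends to 0 pointwise by continuity
    and is dominated, so its mean tends to 0. *)
Lemma small_oscillation (q : nat -> Z) (p : nat * nat -> nat -> Z) :
  (forall z (r : R), 0 < r -> exists n, `|q n - z| < r) ->
  (forall k, (V q k `&` A) !=set0 -> forall j, (V q k `&` A) (p k j)) ->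
  forall z (e : R), A z -> 0 < e -> exists k,
    [/\ V q k z, P.-integrable setT (osc H (p k)) &
        (\int[P]_x osc H (p k) x <= e%:E)%E].
Proof.
move=> qd pV z e Az e0.
have /choice[a az] (n : nat) : exists a : nat, `|q a - z| < n.+1%:R^-1.
  by apply: qd; rewrite invr_gt0.
pose k n := (a n, n).
have Vk n : V q (k n) z by exact: az.
have pVA n j : (V q (k n) `&` A) (p (k n) j) by apply: pV; exists z.
have near_z n j : `|p (k n) j - z| < 2 * n.+1%:R^-1.
  rewrite mulrDl mul1r (le_lt_trans (ler_distD (q (a n)) _ _))// ltrD//.
  by rewrite distrC; case: (pVA n j).
have small (r : R) : 0 < r -> exists N, forall n, (N <= n)%N -> 2 * n.+1%:R^-1 < r.
  move=> r0.
  have [N _ HN] := near_infty_natSinv_lt (PosNum (divr_gt0 r0 (@ltr0Sn R 1))).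
  by exists N => n /HN /=; rewrite ltr_pdivlMr// mulrC.
have [r [c [r0 ic Hc]]] := domH Az.
have [N HN] := small r r0.
have mosc n : measurable_fun setT (osc H (p (k n))).
  by apply: measurable_osc => j; apply: mH; case: (pVA n j).
have : (\int[P]_x osc H (p (k (n + N)%N)) x)%E @[n --> \oo] --> 0%E.
  have := @dominated_convergence _ _ _ P setT measurableT
    (fun n x => osc H (p (k (n + N)%N)) x) (cst 0%E) (fun x => (2%:E * (c x)%:E))%E.
  rewrite integral0; case => //.
  - apply: filterS cH => x cHx _.
    have osc_small (e1 : R) : 0 < e1 ->
        \forall n \near \oo, (osc H (p (k (n + N)%N)) x <= e1%:E)%E.
      move=> e10.
      have e12 : 0 < e1 / 2 by rewrite divr_gt0.
      have /cvgrPdist_lt/(_ _ e12)/nbhs_ballP[r1 /= r10 rH] := cHx z.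
      have [N1 HN1] := small r1 r10; exists N1 => // n /= Nn.
      apply: osc_le => j; rewrite lee_fin.
      have close i : `|H x z - H x (p (k (n + N)%N) i)| < e1 / 2.
        apply: rH; rewrite -ball_normE /= distrC.
        by rewrite (lt_trans (near_z _ _))// HN1// (leq_trans Nn)// leq_addr.
      rewrite (splitr e1) (le_trans (ler_distD (H x z) _ _))// lerD ?ltW//.
      by rewrite distrC.
    apply/fine_cvgP; split.
      apply: filterS (osc_small 1 ltr01) => n o1.
      by rewrite ge0_fin_numE ?osc_ge0// (le_lt_trans o1)// ltry.
    apply/cvgrPdist_le => e1 e10; apply: filterS (osc_small e1 e10) => n o1.
    rewrite sub0r normrN ger0_norm ?fine_ge0 ?osc_ge0//.
    by rewrite -lee_fin fineK// ge0_fin_numE ?osc_ge0// (le_lt_trans o1)// ltry.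
  - exact: integrableZl.
  - apply: filterS Hc => x Hcx n _.
    rewrite gee0_abs ?osc_ge0//; apply: osc_le => j; rewrite -EFinM lee_fin.
    rewrite (le_trans (ler_normB _ _))// mulr_natl mulr2n lerD// Hcx//.
    - by case: (pVA (n + N)%N j).
    - by rewrite ltW// (lt_trans (near_z _ _))// HN// leq_addl.
    - by case: (pVA (n + N)%N 0%N).
    - by rewrite ltW// (lt_trans (near_z _ _))// HN// leq_addl.
move=> /fine_cvgP[[N1 _ fN1]] /cvgrPdist_le/(_ e e0)[N2 _ eN2].
pose n := maxn N1 N2.
have fn := fN1 n (leq_maxl _ _).
have oe : (\int[P]_x osc H (p (k (n + N)%N)) x <= e%:E)%E.
  rewrite -(fineK fn) lee_fin; have := eN2 n (leq_maxr _ _).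
  rewrite /= sub0r normrN ger0_norm// fine_ge0// integral_ge0// => x _.
  exact: osc_ge0.
exists (k (n + N)%N); split => //; apply/integrableP; split => //.
under eq_integral do rewrite gee0_abs ?osc_ge0//.
by rewrite (le_lt_trans oe)// ltry.
Qed.

(** On a ball of small mean oscillation, the empirical mean at z' differs from the
    one at the center by at most the empirical mean of the oscillation.  Only the
    oscillations and the centers of countably many balls are involved, so a single
    almost sure event serves all z. *)
Lemma uniform_lln : {ae Pr, forall w, forall z, A z -> forall e : R, 0 < e ->
  exists2 r : R, 0 < r & exists N, forall n, (N <= n)%N -> forall z', A z' ->
    `|z' - z| < r ->
    `|(\sum_(j < n.+1) H (X j w) z') / n.+1%:R - \int[P]_x H x z| < e}.
Proof.
have [q qd] := dense_sequence sepZ.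
have /choice[p pP] (k : nat * nat) : exists p : nat -> Z, (V q k `&` A) !=set0 ->
    (forall j, (V q k `&` A) (p j)) /\
    forall z, (V q k `&` A) z -> forall r : R, 0 < r -> exists n, `|p n - z| < r.
  have [/(dense_sequence_in sepZ)[p pS]|nex] := pselect ((V q k `&` A) !=set0).
    by exists p.
  by exists (fun=> 0).
pose good k := P.-integrable setT (osc H (p k)).
have ae_osc : {ae P, forall x, continuous (H x) /\
    forall a b, good (a, b) -> osc H (p (a, b)) x \is a fin_num}.
  have ae_fin : {ae P, forall x, forall a b, good (a, b) ->
      osc H (p (a, b)) x \is a fin_num}.
    apply: ae_foralln => a; apply: ae_foralln => b.
    have [g|ng] := pselect (good (a, b)); last by apply: aeW.
    by apply: filterS (integrable_ae measurableT g) => x fx _; exact: fx.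
  by apply: filterS2 cH ae_fin.
have ae_center : {ae Pr, forall w, forall a b, (V q (a, b) `&` A) !=set0 ->
    (\sum_(j < n.+1) H (X j w) (p (a, b) 0%N)) / n.+1%:R @[n --> \oo] -->
    \int[P]_x H x (p (a, b) 0%N)}.
  apply: ae_foralln => a; apply: ae_foralln => b.
  have [g|ng] := pselect ((V q (a, b) `&` A) !=set0); last by apply: aeW.
  have [/(_ 0%N)[_ Ap] _] := pP (a, b) g.
  by apply: filterS (slln iidX (iH Ap)) => w.
have ae_avg : {ae Pr, forall w, forall a b, good (a, b) ->
    (\sum_(j < n.+1) fine (osc H (p (a, b)) (X j w))) / n.+1%:R @[n --> \oo] -->
    \int[P]_x fine (osc H (p (a, b)) x)}.
  apply: ae_foralln => a; apply: ae_foralln => b.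
  have [g|ng] := pselect (good (a, b)); last by apply: aeW.
  have gf : P.-integrable setT (EFin \o (fine \o osc H (p (a, b)))).
    apply: le_integrable (g) => //.
      by apply/measurable_EFinP; apply: measurableT_comp (measurable_int _ g).
    move=> x _ /=; rewrite ger0_norm ?fine_ge0 ?osc_ge0// gee0_abs ?osc_ge0//.
    by case: osc (osc_ge0 H (p (a, b)) x) => [r| |]//= _; rewrite lexx.
  by apply: filterS (slln iidX gf) => w.
apply: filterS3 (ae_iid iidX ae_osc) ae_center ae_avg => w wosc wcen wavg z Az e e0.
have e4 : 0 < e / 4 by rewrite divr_gt0.
have [|[a b] [Vz gk ok]] := small_oscillation qd _ Az e4 (p := p).
  by move=> k /pP[].
have VA0 : (V q (a, b) `&` A) !=set0 by exists z.
have [pVA pdense] := pP (a, b) VA0.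
set p0 := p (a, b) 0%N.
have Ap0 : A p0 by case: (pVA 0%N).
have center : `|\int[P]_x H x p0 - \int[P]_x H x z| <= e / 4.
  rewrite -RintegralB//; [|exact: iH|exact: iH].
  have idiff : P.-integrable setT (EFin \o (fun x => H x p0 - H x z)).
    by apply: (integrableB measurableT (iH Ap0) (iH Az)).
  rewrite -lee_fin; apply: le_trans ok.
  rewrite EFin_normr_Rintegral// (le_trans (le_abse_integral _ _ _))//.
    exact: measurable_int idiff.
  apply: ae_ge0_le_integral => //.
  - by apply: measurableT_comp => //; exact: measurable_int idiff.
  - by move=> x _; exact: osc_ge0.
  - exact: measurable_int gk.
  - apply: filterS cH => x cHx _ /=; rewrite distrC.
    by apply: (osc_sup pdense cHx); split.
have mean_osc : \int[P]_x fine (osc H (p (a, b)) x) <= e / 4.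
  rewrite -lee_fin /Rintegral.
  have -> : (\int[P]_x (fine (osc H (p (a, b)) x))%:E =
      \int[P]_x osc H (p (a, b)) x)%E.
    apply: ae_eq_integral => //.
    - by apply/measurable_EFinP; apply: measurableT_comp (measurable_int _ gk).
    - exact: measurable_int gk.
    - by apply: filterS ae_osc => x [_ /(_ a b gk) fx] _; rewrite fineK.
  by rewrite fineK// integrable_fin_num.
have [N1 _ HN1] := (cvgrPdist_lt _ _).1 (wcen a b VA0) _ e4.
have [N2 _ HN2] := (cvgrPdist_lt _ _).1 (wavg a b gk) _ e4.
exists (b.+1%:R^-1 - `|q a - z|); first by rewrite subr_gt0.
exists (maxn N1 N2) => n; rewrite geq_max => /andP[Nn1 Nn2] z' Az' z'z.
have Vz' : (V q (a, b) `&` A) z'.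
  split => //; rewrite /V /= (le_lt_trans (ler_distD z _ _))//.
  by rewrite (distrC z z') -ltrBrDl.
set avg := fun z => (\sum_(j < n.+1) H (X j w) z) / n.+1%:R.
have diff : `|avg z' - avg p0| <=
    (\sum_(j < n.+1) fine (osc H (p (a, b)) (X j w))) / n.+1%:R.
  rewrite /avg -mulrBl normrM (ger0_norm (_ : 0 <= n.+1%:R^-1))//.
  rewrite ler_wpM2r// -sumrB.
  rewrite (le_trans (ler_norm_sum _ _ _))//; apply: ler_sum => j _.
  have [cHj fj] := wosc j.
  by rewrite -lee_fin fineK; [exact: (osc_sup pdense cHj Vz')|exact: fj].
have := HN1 n Nn1; have := HN2 n Nn2; rewrite /= -/(avg p0) => h2 h1.
rewrite (le_lt_trans (ler_distD (avg p0) _ _))//.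
have h3 : `|avg p0 - \int[P]_x H x z| <=
   `|\int[P]_x H x p0 - avg p0| + `|\int[P]_x H x p0 - \int[P]_x H x z|.
  by rewrite [X in _ <= X + _]distrC; exact: ler_distD.
move: h2; rewrite ltr_distl ltrBlDr => /andP[h2 _].
have h4 := le_lt_trans diff h2; rewrite -/(avg z').
have -> : e = e / 4 + e / 4 + (e / 4 + e / 4) by lra.
rewrite ltr_leD//; first by rewrite (lt_le_trans h4)// lerD2r.
by rewrite (le_trans h3)// lerD// ltW.
Qed.

End uniform_lln.

(** * Sample means of the approximating integrands *)

Lemma row_entry_le (R : realType) m (v : 'rV[R]_m) i : `|v 0 i| <= `|v|.
Proof.
rewrite [leRHS]mx_normrE.
exact: (le_bigmax 0 (fun ij : 'I_1 * 'I_m => `|v ij.1 ij.2|) (0, i)).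
Qed.

Lemma norm2_le (R : realType) n (x : 'rV[R]_n) :
  norm2 x <= Num.sqrt n%:R * `|x|.
Proof.
rewrite -(ger0_norm (normr_ge0 x)) -sqrtr_sqr -sqrtrM// ler_wsqrtr//.
rewrite -[leRHS](_ : \sum_(i < n) `|x| ^+ 2 = _); last first.
  by rewrite sumr_const card_ord mulr_natl.
apply: ler_sum => i _; rewrite -real_normK ?num_real// ler_sqr ?nnegrE//.
exact: row_entry_le.
Qed.

Lemma ball2_nbhs (R : realType) n (x : 'rV[R]_n) (rho : R) : 0 < rho ->
  exists2 r : R, 0 < r & forall y, `|y - x| < r -> ball2 x rho y.
Proof.
move=> rho0; exists (rho / (Num.sqrt n%:R + 1)) => [|y].
  by rewrite divr_gt0// ltr_wpDl// sqrtr_ge0.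
rewrite ltr_pdivlMr ?ltr_wpDl ?sqrtr_ge0// => yx; rewrite /ball2 /=.
rewrite (le_trans (norm2_le _))// (le_trans _ (ltW yx))// mulrC.
by rewrite ler_wpM2l// lerDl.
Qed.

Lemma ereal_sup_image_lty (R : realType) (Y : Type) (B : set Y) (f : Y -> R) :
  (ereal_sup [set (f y)%:E | y in B] < +oo)%E ->
  exists2 C, 0 <= C & forall y, B y -> f y <= C.
Proof.
move=> fB; exists (Num.max 0 (fine (ereal_sup [set (f y)%:E | y in B]))).
  by rewrite le_max lexx.
move=> y By; rewrite le_max; apply/orP; right.
have ub : ((f y)%:E <= ereal_sup [set (f y)%:E | y in B])%E.
  by apply: ereal_sup_ubound; exists y.
rewrite -lee_fin fineK// fin_numElt fB andbT.
by apply: lt_le_trans ub; rewrite ltNyr.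
Qed.

(** Here g0 = g(s), g1 = g(s_nu) and g2 = g_nu(s_nu), while a, b and c stand for the
    norms of s_nu, s and s_nu - s.  The bound isolates the two functions of the
    random element whose integrability is assumed. *)
Lemma performance_gap (R : realType)
    (eta kappa eps p lam mu D0 D a b c g0 g1 g2 : R) :
  0 < eta -> 0 < kappa -> 0 <= p -> 0 <= lam -> 0 <= mu -> 0 <= D0 -> 0 <= D ->
  0 <= a -> 0 <= b -> 0 <= c ->
  `|g2 - g1| <= eps ->
  `|g1 - g0| <= p * (a `^ eta + b `^ eta + 1) * c `^ kappa ->
  Num.max b a <= lam * D0 -> c <= mu * D ->
  `|g2 - g0| <= eps +
    p * (2 * D0 `^ eta * (lam `^ eta * mu `^ kappa) + mu `^ kappa) * D `^ kappa.
Proof.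
move=> eta0 kappa0 p0 lam0 mu0 D00 D_0 a0 b0 c0 h21 h10.
rewrite ge_max => /andP[bl al] cm.
rewrite (le_trans (ler_distD g1 _ _))// lerD// (le_trans h10)//.
have pow x : 0 <= x -> x <= lam * D0 -> x `^ eta <= lam `^ eta * D0 `^ eta.
  move=> x0 xl; rewrite -powRM//; apply: ge0_ler_powR; rewrite ?nnegrE ?(ltW eta0)//.
  by rewrite mulr_ge0.
have powc : c `^ kappa <= mu `^ kappa * D `^ kappa.
  rewrite -powRM//; apply: ge0_ler_powR; rewrite ?nnegrE ?(ltW kappa0)//.
  by rewrite mulr_ge0.
rewrite -!mulrA ler_wpM2l//.
apply: (@le_trans _ _
  ((2 * (lam `^ eta * D0 `^ eta) + 1) * (mu `^ kappa * D `^ kappa))).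
  apply: ler_pM; rewrite ?powR_ge0 ?addr_ge0 ?powR_ge0//.
  by rewrite lerD2r mulr_natl mulr2n lerD// pow.
by rewrite le_eqVlt; apply/orP; left; apply/eqP; ring.
Qed.

(** Averaging the bound of [performance_gap] leaves the empirical means of L and M,
    which stay below l1 + 1 and l2 + 1; the remaining factor D nu y `^ kappa tends
    to 0 uniformly near y0. *)
Lemma sample_means_close (R : realType) k m (Xi : Type) (x : nat -> Xi)
    (A : set 'rV[R]_k) (y0 : 'rV[R]_k)
    (G : 'I_m -> Xi -> 'rV[R]_k -> R) (Gnu : nat -> 'I_m -> Xi -> 'rV[R]_k -> R)
    (eps : nat -> R) (p D0 : 'rV[R]_k -> R) (D : nat -> 'rV[R]_k -> R)
    (L M : Xi -> R) (eta kappa rho l1 l2 : R) :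
  let B := ball2 y0 rho `&` A in
  0 < kappa -> 0 < eta -> 0 < rho -> eps @ \oo --> 0 ->
  (forall x, 0 <= L x) -> (forall x, 0 <= M x) ->
  (forall y, A y -> [/\ 0 <= p y, 0 <= D0 y & forall nu, 0 <= D nu y]) ->
  (forall j nu i y, A y -> `|Gnu nu i (x j) y - G i (x j) y| <=
    eps nu + p y * (2 * D0 y `^ eta * L (x j) + M (x j)) * D nu y `^ kappa) ->
  (\sum_(j < nu.+1) L (x j)) / nu.+1%:R @[nu --> \oo] --> l1 ->
  (\sum_(j < nu.+1) M (x j)) / nu.+1%:R @[nu --> \oo] --> l2 ->
  (ereal_sup [set (p y)%:E | y in B] < +oo)%E ->
  (ereal_sup [set (D0 y)%:E | y in B] < +oo)%E ->
  (fun nu => ereal_sup [set (D nu y)%:E | y in B]) @ \oo --> 0%E ->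
  forall e : R, 0 < e -> exists2 r : R, 0 < r & exists N, forall nu, (N <= nu)%N ->
    forall y, A y -> `|y - y0| < r -> forall i,
    `|(\sum_(j < nu.+1) Gnu nu i (x j) y) / nu.+1%:R -
      (\sum_(j < nu.+1) G i (x j) y) / nu.+1%:R| < e.
Proof.
move=> B kappa0 eta0 rho0 eps0 L0 M0 pos gap cL cM.
move=> /ereal_sup_image_lty[C C0 pC] /ereal_sup_image_lty[C' C'0 D0C] Dcvg e e0.
have l10 : 0 <= l1.
  rewrite -(cvg_lim _ cL)//; apply: limr_ge (cvgP _ cL) _.
  by apply: nearW => n; rewrite divr_ge0// sumr_ge0.
have l20 : 0 <= l2.
  rewrite -(cvg_lim _ cM)//; apply: limr_ge (cvgP _ cM) _.
  by apply: nearW => n; rewrite divr_ge0// sumr_ge0.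
pose K := C * (2 * C' `^ eta * (l1 + 1) + (l2 + 1)).
have K0 : 0 <= K.
  by rewrite /K mulr_ge0// addr_ge0 ?mulr_ge0 ?powR_ge0 ?addr_ge0.
(* D nu y is eventually at most t `^ kappa^-1, so that the gap is at most K * t *)
pose t := (e / 2 / (K + 1)).
have t0 : 0 < t by rewrite !divr_gt0// ltr_wpDl.
have tk : (t `^ kappa^-1) `^ kappa = t.
  by rewrite -powRrM mulVf ?gt_eqF// powRr1// ltW.
have Kt : K * t < e / 2.
  rewrite /t mulrCA gtr_pMr ?divr_gt0// ltr_pdivrMr ?ltr_wpDl// mul1r.
  by rewrite ltrDl.
have [r r0 rB] := ball2_nbhs y0 rho0.
exists r => //.
have [N1 _ HN1] := (cvgrPdist_lt _ _).1 eps0 _ (divr_gt0 e0 (@ltr0Sn R 1)).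
have [N2 _ HN2] := (cvgrPdist_le _ _).1 cL _ ltr01.
have [N3 _ HN3] := (cvgrPdist_le _ _).1 cM _ ltr01.
have [N4 _ HN4] : \forall nu \near \oo,
    (ereal_sup [set (D nu y)%:E | y in B] < (t `^ kappa^-1)%:E)%E.
  have t1 : (0 < (t `^ kappa^-1)%:E)%E by rewrite lte_fin powR_gt0.
  exact: (Dcvg _ (open_ereal_lt' t1)).
exists (maxn (maxn N1 N2) (maxn N3 N4)) => nu; rewrite !geq_max.
move=> /andP[/andP[h1 h2] /andP[h3 h4]] y Ay yr i.
have By : B y by split => //; exact: rB.
have [py0 D0y0 Dy0] := pos y Ay.
have Dnu : D nu y `^ kappa <= t.
  rewrite -tk; apply: ge0_ler_powR; rewrite ?nnegrE ?powR_ge0 ?(ltW kappa0)//.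
  rewrite -lee_fin (le_trans _ (ltW (HN4 nu h4)))//.
  by apply: ereal_sup_ubound; exists y.
set aL := (\sum_(j < nu.+1) L (x j)) / nu.+1%:R.
set aM := (\sum_(j < nu.+1) M (x j)) / nu.+1%:R.
have aL1 : aL <= l1 + 1.
  by have := HN2 nu h2; rewrite /= -/aL distrC ler_distl => /andP[].
have aM1 : aM <= l2 + 1.
  by have := HN3 nu h3; rewrite /= -/aM distrC ler_distl => /andP[].
have aL0 : 0 <= aL by rewrite divr_ge0// sumr_ge0.
have aM0 : 0 <= aM by rewrite divr_ge0// sumr_ge0.
have av0 : 0 <= 2 * D0 y `^ eta * aL + aM.
  by rewrite addr_ge0// mulr_ge0// mulr_ge0// powR_ge0.
have ep : eps nu < e / 2.
  by have := HN1 nu h1; rewrite /= sub0r normrN; apply: le_lt_trans; rewrite ler_norm.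
rewrite -mulrBl normrM (ger0_norm (_ : 0 <= nu.+1%:R^-1))// -sumrB.
apply: (@le_lt_trans _ _
  (eps nu + p y * (2 * D0 y `^ eta * aL + aM) * D nu y `^ kappa)).
  rewrite ler_pdivrMr//.
  apply: le_trans (ler_norm_sum _ _ _) _.
  apply: (@le_trans _ _ (\sum_(j < nu.+1) (eps nu + p y *
      (2 * D0 y `^ eta * L (x j) + M (x j)) * D nu y `^ kappa))).
    by apply: ler_sum => j _; exact: gap.
  rewrite big_split /= sumr_const card_ord -[eps nu *+ _]mulr_natr.
  rewrite [leRHS]mulrDl lerD2l -mulr_suml -mulr_sumr big_split /= -mulr_sumr.
  rewrite /aL /aM le_eqVlt; apply/orP; left; apply/eqP; field.
  by rewrite addrC natr1 pnatr_eq0.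
rewrite (splitr e) ltr_leD// (le_trans _ (ltW Kt))// ler_pM//.
- by rewrite mulr_ge0.
- exact: powR_ge0.
rewrite /K ler_pM// ?pC//.
rewrite lerD// ler_pM// ?mulr_ge0 ?powR_ge0//.
rewrite ler_wpM2l//; apply: ge0_ler_powR; rewrite ?nnegrE ?(ltW eta0)//.
exact: D0C.
Qed.

(** * Cluster points of near-minimizers *)

Lemma lt_EFin_gap (R : realType) (x : \bar R) (t : R) : (x < t%:E)%E ->
  exists2 e : R, 0 < e & (x < (t - e)%:E)%E.
Proof.
case: x => [r| |]//.
  rewrite lte_fin => rt; exists ((t - r) / 2); first by rewrite divr_gt0// subr_gt0.
  by rewrite lte_fin; lra.
by move=> _; exists 1; rewrite ?ltNyr.
Qed.

Section composite.
Context (R : realType) (Y : Type) (m : nat).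
Variables (C : set Y) (f : Y -> R) (h : 'rV[R]_m -> \bar R) (w : Y -> 'rV[R]_m).

(** A strict bound by a real number becomes an inequality on h alone, whatever infinite
    values occur; the later arguments only compare objectives through such bounds. *)
Lemma composite_objective_lt y (t : R) :
  (composite_objective C f h w y < t%:E)%E <->
  C y /\ (h (w y) < (t - f y)%:E)%E.
Proof.
rewrite /composite_objective /indicator; case: asboolP => Cy; last first.
  by case: (h (w y)) => [r| |]; split => //= -[].
case: (h (w y)) => [r| |]; split => //=.
- by rewrite !lte_fin => ?; split => //; lra.
- by rewrite !lte_fin => -[_ ?]; lra.
- by case.
- by move=> _; split => //; rewrite ltNyr.
- by move=> _; exact: ltNyr.
Qed.

Lemma composite_objective_gt y (t : R) : C y ->
  (t%:E < composite_objective C f h w y)%E <-> ((t - f y)%:E < h (w y))%E.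
Proof.
rewrite /composite_objective /indicator => Cy; case: asboolP => // _.
case: (h (w y)) => [r| |] => /=.
- by rewrite !lte_fin; split => ?; lra.
- by split => _; rewrite ltry.
- by split.
Qed.

Lemma composite_objective_lty y :
  (composite_objective C f h w y < +oo)%E -> C y /\ (h (w y) < +oo)%E.
Proof.
rewrite /composite_objective /indicator; case: asboolP => Cy.
  by case: (h (w y)) => [r| |] //= _; split; rewrite ?ltry.
by case: (h (w y)).
Qed.

End composite.

Definition continuous_on (R : realType) (Y : normedModType R) (C : set Y)
    (f : Y -> R) :=
  forall y, C y -> forall e : R, 0 < e ->
  exists2 r : R, 0 < r & forall y', C y' -> `|y' - y| < r -> `|f y' - f y| < e.

Lemma within_continuous_on (R : realType) (Z : normedModType R) (A : set Z)
    (f : Z -> R) :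
  {within A, continuous f} -> continuous_on A f.
Proof.
move=> /subspace_continuousP cf z Az e e0.
have /cvgrPdist_lt/(_ e e0) := cf z Az.
rewrite near_withinE => /nbhs_ballP[r /= r0 rf]; exists r => // z' Az' z'z.
rewrite distrC; apply: rf => //.
by rewrite -ball_normE /= distrC.
Qed.

Lemma continuous_on_comp (R : realType) (Y Z : normedModType R) (A : set Z)
  (f : Z -> R) (T : Y -> Z) :
  continuous T -> continuous_on A f -> continuous_on (T @^-1` A) (f \o T).
Proof.
move=> cT cf y Ay e e0; have [r r0 rf] := cf _ Ay e e0.
have /cvgrPdist_lt/(_ r r0)/nbhs_ballP[r' /= r'0 rT] := cT y.
exists r' => // y' Ay' y'y; apply: rf => //.
rewrite distrC; apply: rT.
by rewrite -ball_normE /= distrC.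
Qed.

Definition locally_uniform_cvg (R : realType) (Y : normedModType R) m (C : set Y)
    (wnu : nat -> Y -> 'rV[R]_m) (w : Y -> 'rV[R]_m) :=
  forall y, C y -> forall e : R, 0 < e ->
  exists2 r : R, 0 < r & exists N, forall nu, (N <= nu)%N ->
    forall y', C y' -> `|y' - y| < r -> `|wnu nu y' - w y| < e.

(** The lower half of epi-convergence, as a neighbourhood condition rather than along
    sequences: this form can be applied along a subsequence of the indices. *)
Definition lower_epi_limit (R : realType) m (hnu : nat -> 'rV[R]_m -> \bar R)
    (h : 'rV[R]_m -> \bar R) :=
  forall w (t : R), (t%:E < h w)%E -> exists2 e : R, 0 < e &
    exists N, forall nu, (N <= nu)%N -> forall w', `|w' - w| < e ->
      (t%:E < hnu nu w')%E.

(** If the neighbourhood condition failed, there would be indices nu_N >= N and points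
    within 1/(N+1) of w with values at most t.  As nu_N >= N, each index is hit only
    finitely often, so filling the other indices with w yields a sequence tending to
    w whose values have a lower limit at most t. *)
Lemma liminf_lower_epi_limit (R : realType) m (hnu : nat -> 'rV[R]_m -> \bar R)
    (h : 'rV[R]_m -> \bar R) :
  (forall (wnu : nat -> 'rV[R]_m) w, wnu @ \oo --> w ->
     (h w <= limn_einf (fun nu => hnu nu (wnu nu)))%E) ->
  lower_epi_limit hnu h.
Proof.
move=> liminf w t th; apply: contrapT => nex.
have bad (N : nat) : exists k : nat * 'rV[R]_m,
    [/\ (N <= k.1)%N, `|k.2 - w| < N.+1%:R^-1 & (hnu k.1 k.2 <= t%:E)%E].
  apply: contrapT => nbad; apply: nex; exists N.+1%:R^-1; first by rewrite invr_gt0.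
  exists N => nu Nnu w' w'w; rewrite ltNge; apply/negP => hle.
  by apply: nbad; exists (nu, w').
have [k kP] := choice bad.
have /choice[v vP] (nu : nat) : exists v : 'rV[R]_m,
    ((exists N, (k N).1 = nu) -> exists2 N, (k N).1 = nu & v = (k N).2) /\
    (~ (exists N, (k N).1 = nu) -> v = w).
  have [[N kN]|nN] := pselect (exists N, (k N).1 = nu); last by exists w.
  by exists (k N).2; split => [_|[]]; exists N.
have vw : v @ \oo --> w.
  apply/cvgrPdist_lt => e e0.
  have [N0 _ HN0] := near_infty_natSinv_lt (PosNum e0).
  exists (\max_(N < N0) (k N).1).+1 => // nu /= lenu.
  have [v1 v2] := vP nu.
  have [ex|/v2 ->] := pselect (exists N, (k N).1 = nu); last by rewrite subrr normr0.
  have [N kN ->] := v1 ex; have [_ kw _] := kP N.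
  rewrite distrC (lt_trans kw)//; apply: HN0 => /=.
  rewrite leqNgt; apply/negP => NN0.
  by move: lenu; rewrite ltnNge -kN (leq_bigmax (Ordinal NN0)).
have := liminf v w vw; apply/negP; rewrite -ltNge.
apply: le_lt_trans th; rewrite limn_einf_lim.
apply: lime_le; first exact: is_cvg_einfs.
apply: nearW => n; have [nk _ hk] := kP n.
have [N kN vE] : exists2 N, (k N).1 = (k n).1 & v (k n).1 = (k N).2.
  by have [v1 _] := vP (k n).1; apply: v1; exists n.
have [_ _ hN] := kP N.
apply: (@le_trans _ _ (hnu (k n).1 (v (k n).1))).
  by apply: ereal_inf_lbound; exists (k n).1.
by rewrite vE -kN.
Qed.

Section near_optimal_clusters.
Context (R : realType) (Y : normedModType R) (m : nat) (C : set Y) (f : Y -> R).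
Variables (h : 'rV[R]_m -> \bar R) (hnu : nat -> 'rV[R]_m -> \bar R).
Variables (w : Y -> 'rV[R]_m) (wnu : nat -> Y -> 'rV[R]_m).
Hypotheses (closedC : closed C) (cf : continuous_on C f).
Hypothesis wnuw : locally_uniform_cvg C wnu w.

Local Notation phi := (composite_objective C f h w).
Local Notation phinu nu := (composite_objective C f (hnu nu) (wnu nu)).

(** The upper half of epi-convergence that near-minimizers require: the recovery
    point y' may depend on the index. *)
Definition upper_approximable :=
  forall y (t : R), C y -> (phi y < t%:E)%E ->
    exists N, forall nu, (N <= nu)%N -> exists y', (phinu nu y' < t%:E)%E.

(** If phi zbar exceeded phi y + delta by 4 e, then the lower half would keep the
    objectives near zbar above phi y + delta + 3 e, whereas the upper half bounds
    their infima by phi y + e and hence the values at the near-minimizers by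
    phi y + delta + 2 e. *)
Lemma cluster_near_optimal (delta_ : nat -> R) (delta : R) (zs : nat -> Y) (zbar : Y) :
  lower_epi_limit hnu h -> upper_approximable ->
  (forall w, (-oo < h w)%E) ->
  delta_ @ \oo --> delta ->
  (forall nu, delta_argmin (delta_ nu) (phinu nu) (zs nu)) ->
  cluster (zs @ \oo) zbar ->
  forall y, (phi zbar <= phi y + delta%:E)%E.
Proof.
move=> lower upper hNy dcvg zsP clz y.
have often N (r : R) : 0 < r -> exists2 nu, (N <= nu)%N & `|zs nu - zbar| < r.
  move=> r0; have [||_ [[nu /= Nnu <-] zr]] :=
      clz (zs @` [set nu | (N <= nu)%N]) (ball zbar r).
  - by exists N => // nu /= Nnu; exists nu.
  - exact: nbhsx_ballx.
  by exists nu => //; move: zr; rewrite -ball_normE /= distrC.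
have Czs nu : C (zs nu).
  by have [lty _] := zsP nu; have [] := composite_objective_lty lty.
have Czbar : C zbar.
  apply: closedC => B /nbhs_ballP[r /= r0 rB].
  have [nu _ zr] := often 0%N r r0.
  exists (zs nu); split => //; apply: rB.
  by rewrite -ball_normE /= distrC.
rewrite leNgt; apply/negP => lt_phi.
have phiyNy : (-oo < phi y)%E.
  rewrite /composite_objective /indicator; case: asboolP => _.
    by have := hNy (w y); case: (h (w y)) => [r| |]//= _; rewrite ltNyr.
  by case: (h (w y)).
have phiy_lty : (phi y < +oo)%E.
  by move: lt_phi; case: (phi y) phiyNy => // _; case: (phi zbar).
have phiy_fin : phi y \is a fin_num by rewrite fin_numElt phiyNy phiy_lty.
have [Cy _] := composite_objective_lty phiy_lty.
have [t0 phiyt0] : exists t0 : R, phi y = t0%:E.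
  by exists (fine (phi y)); rewrite fineK.
have [e e0 eP] : exists2 e : R, 0 < e & ((t0 + delta + 4 * e)%:E < phi zbar)%E.
  move: lt_phi; rewrite phiyt0 -EFinD; case: (phi zbar) => [r| |]//.
    rewrite lte_fin => tr; exists ((r - (t0 + delta)) / 5).
      by rewrite divr_gt0// subr_gt0.
    by rewrite lte_fin; lra.
  by move=> _; exists 1; rewrite ?ltry.
have phiyt1 : (phi y < (t0 + e)%:E)%E by rewrite phiyt0 lte_fin ltrDl.
have [N1 HN1] := upper y (t0 + e) Cy phiyt1.
have [N2 _ HN2] := (cvgrPdist_lt _ _).1 dcvg e e0.
have [r1 r10 fr1] := cf Czbar e0.
have [e' e'0 [N3 HN3]] := lower _ _ ((composite_objective_gt f h w _ Czbar).1 eP).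
have [r2 r20 [N4 HN4]] := wnuw Czbar e'0.
have r0 : 0 < Num.min r1 r2 by rewrite lt_min r10.
have [nu] := often (maxn (maxn N1 N2) (maxn N3 N4)) _ r0.
rewrite !geq_max => /andP[/andP[h1 h2] /andP[h3 h4]].
rewrite lt_min => /andP[z1 z2].
have [y' y't] := HN1 nu h1.
have d2 : delta_ nu < delta + e.
  by have := HN2 nu h2; rewrite /= ltr_distlC => /andP[].
have : (phinu nu (zs nu) < (t0 + delta + 3 * e)%:E)%E.
  have [_ zle] := zsP nu; apply: le_lt_trans zle _.
  apply: (@le_lt_trans _ _ ((t0 + e)%:E + (delta_ nu)%:E)%E).
    rewrite leeD2r// (le_trans _ (ltW y't))//.
    by apply: ereal_inf_lbound; exists y'.
  by rewrite -EFinD lte_fin; lra.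
move=> /composite_objective_lt[_].
have := HN3 nu h3 _ (HN4 nu h4 _ (Czs nu) z2).
move=> /lt_trans/[apply]; rewrite lte_fin.
by have := fr1 _ (Czs nu) z1; rewrite ltr_distl => /andP[]; lra.
Qed.

Lemma upper_approximable_cvg :
  (forall (vnu : nat -> 'rV[R]_m) v, vnu @ \oo --> v ->
    (fun nu => hnu nu (vnu nu)) @ \oo --> h v) ->
  upper_approximable.
Proof.
move=> hcvg y t Cy /composite_objective_lt[_ ht].
have wy : (fun nu => wnu nu y) @ \oo --> w y.
  apply/cvgrPdist_lt => e e0; have [r r0 [N HN]] := wnuw Cy e0.
  by exists N => // nu Nnu; rewrite distrC; apply: HN => //; rewrite subrr normr0.
have [N _ HN] := hcvg _ _ wy _ (open_ereal_lt' ht).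
by exists N => nu Nnu; exists y; apply/composite_objective_lt; split => //; exact: HN.
Qed.

(** At a single point of the strict sequence close enough to y, the sample means
    eventually lie componentwise below w y, because they converge to something
    strictly below; monotonicity of h and hnu <= h then bound the value. *)
Lemma upper_approximable_monotone :
  (forall nu v, (hnu nu v <= h v)%E) ->
  (forall v v', lev v v' -> (h v <= h v')%E) ->
  (forall y, C y -> (h (w y) < +oo)%E -> exists ynu : nat -> Y,
    [/\ (forall nu, C (ynu nu)), ynu @ \oo --> y &
        forall nu, ltv (w (ynu nu)) (w y)]) ->
  upper_approximable.
Proof.
move=> hle hmono slater y t Cy phit.
have [_ hlty] := composite_objective_lty (lt_trans phit (ltry t)).
have [_ ht] := (composite_objective_lt _ _ _ _ _ _).1 phit.
have [ynu [Cynu ycvg wlt]] := slater y Cy hlty.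
have [e e0 eP] := lt_EFin_gap ht.
have [r r0 fr] := cf Cy e0.
have [k _ /(_ k (leqnn k)) /= kr] := (cvgrPdist_lt _ _).1 ycvg r r0.
have fk : f (ynu k) < f y + e.
  have := fr _ (Cynu k) ltac:(by rewrite distrC).
  by rewrite ltr_distl => /andP[].
(* the initial value 1 keeps the gap positive when m = 0 *)
pose gap := \big[Num.min/1]_(i < m) (w y 0 i - w (ynu k) 0 i).
have gap0 : 0 < gap.
  by apply: lt_bigmin => // i _; rewrite subr_gt0; exact: wlt.
have [r' r'0 [N HN]] := wnuw (Cynu k) gap0.
exists N => nu Nnu; exists (ynu k); apply/composite_objective_lt; split => //.
have close : `|wnu nu (ynu k) - w (ynu k)| < gap.
  by apply: HN => //; rewrite subrr normr0.
apply: le_lt_trans (hle _ _) _.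
apply: (@le_lt_trans _ _ (h (w y))).
  apply: hmono => i.
  have gi : gap <= w y 0 i - w (ynu k) 0 i by exact: bigmin_le.
  have : (wnu nu (ynu k) - w (ynu k)) 0 i <= `|wnu nu (ynu k) - w (ynu k)|.
    exact: le_trans (ler_norm _) (row_entry_le _ _).
  move=> /le_lt_trans/(_ close); rewrite !mxE => gi'.
  by have := lt_le_trans gi' gi; rewrite ltrBlDr subrK => /ltW.
by apply: lt_trans eP _; rewrite lte_fin; lra.
Qed.

End near_optimal_clusters.

(** * Discretization and the optimality gap *)

Lemma row_norm_lt (R : realType) m (v : 'rV[R]_m) (e : R) : 0 < e ->
  (forall i, `|v 0 i| < e) -> `|v| < e.
Proof.
move=> e0 ve; rewrite [ltLHS]mx_normrE; apply: bigmax_lt => // -[i j] _.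
by rewrite ord1.
Qed.

Lemma cvg_row (R : realType) m (u : nat -> 'rV[R]_m) (v : 'rV[R]_m) :
  (forall i, u n 0 i @[n --> \oo] --> v 0 i) -> u @ \oo --> v.
Proof.
move=> uv; apply/cvgrPdist_lt => e e0.
have : \forall n \near \oo, forall i, `|v 0 i - u n 0 i| < e.
  by apply: filter_forall => i; apply: (cvgrPdist_lt _ _).1 (uv i) _ e0.
by apply: filterS => n ue; apply: row_norm_lt => // i; rewrite !mxE.
Qed.

Section discretization.
Context (R : realType) (Z : normedModType R) (m : nat) (A : set Z) (f : Z -> R).
Variables (h : 'rV[R]_m -> \bar R) (w : Z -> 'rV[R]_m) (Zn : nat -> set Z).
Hypothesis cf : continuous_on A f.
Local Notation phi := (composite_objective A f h w).

(** A strict upper bound on phi z leaves room e for the variation of f along the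
    approximating points. *)
Lemma discretization_upper z t (zs : nat -> Z) :
  A z -> (forall n, (A `&` Zn n) (zs n)) -> zs @ \oo --> z ->
  (forall v : R, (h (w z) < v%:E)%E ->
     \forall n \near \oo, (h (w (zs n)) < v%:E)%E) ->
  (phi z < t%:E)%E ->
  exists N, forall n, (N <= n)%N -> exists2 y, Zn n y & (phi y < t%:E)%E.
Proof.
move=> Az zsP zsz hw /composite_objective_lt[_ /lt_EFin_gap[e e0 he]].
have [r r0 fr] := cf Az e0.
have [N1 _ HN1] := hw _ he.
have [N2 _ HN2] := (cvgrPdist_lt _ _).1 zsz r r0.
exists (maxn N1 N2) => n; rewrite geq_max => /andP[n1 n2].
have [Azn Znz] := zsP n.
exists (zs n) => //; apply/composite_objective_lt; split => //.
apply: lt_trans (HN1 n n1) _; rewrite lte_fin.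
have := fr _ Azn ltac:(by rewrite distrC; exact: HN2 n n2).
by rewrite ltr_distl => /andP[]; lra.
Qed.

End discretization.

Theorem theorem4p11
  (R : realType) (Z U Xi : completeNormedModType R)
  (sepZ : separable_space Z) (sepU : separable_space U) (hilbXi : is_hilbert Xi)
  (d : measure_display) (Omega : measurableType d) (Pr : probability Omega R)
  (xi : {RV Pr >-> borel Xi})
  (m : nat) (A : set Z) (f : Z -> R)
  (h : 'rV[R]_m -> \bar R) (s : Xi -> Z -> U) (g : 'I_m -> U * Z -> R)
  (Zn : nat -> set Z) (T : forall n : nat, 'rV[R]_n.+1 -> Z)
  (hT : forall n, range (T n) = Zn n)
  (hnu : nat -> 'rV[R]_m -> \bar R) (snu : nat -> Xi -> Z -> U)
  (gnu : nat -> 'I_m -> U * Z -> R)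
  (xis : nat -> {RV Pr >-> borel Xi}) (nbar : nat) :
  let XiP := completion_type (distribution Pr xi) in
  let P : probability XiP R := completion (distribution Pr xi) in
  let G := performance g s in
  let EG := fun z : Z => expectation_vec P (fun x : XiP => G x z) in
  let Gnu := fun nu => performance (gnu nu) (snu nu) in
  let phi := composite_objective A f h EG in
  let An := fun n => T n @^-1` A in
  let phin := fun n => phi \o T n in
  let phinnu := fun (w : Omega) (n nu : nat) =>
    composite_objective (An n) (f \o T n) (hnu nu)
      (fun zn => sample_mean (fun x => Gnu nu x (T n zn)) (fun j => xis j w) nu) in
  (forall z, A z -> forall i,
     P.-integrable [set: XiP] (fun x : XiP => (G x z 0 i)%:E)) ->
  (-oo < ereal_inf (range phi))%E ->
  closed A ->
  {within A, continuous f} ->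
  mutually_independent xis ->
  identically_distributed_as xis xi ->
  (* (B_Z) *)
  (forall zbar, A zbar ->
     measurable_fun [set: XiP] ((fun x => G x zbar) : XiP -> borel 'rV[R]_m) /\
     exists (rho : R) (c : Xi -> R),
       [/\ 0 < rho, (forall x, 0 <= c x),
           P.-integrable [set: XiP] (fun x : XiP => (c x)%:E) &
           {ae P, forall x : XiP, forall z, A z -> `|z - zbar| <= rho ->
              `|G x z| <= c x}]) ->
  (forall n, (nbar <= n)%N ->
     (ereal_inf (range (phin n)) < +oo)%E /\
     (* continuity *)
     [/\ {ae P, forall x : XiP, continuous (s x)},
         (forall i, continuous (g i)), continuous (T n) &
         forall zn, measurable_fun [set: XiP]
           ((fun x => G x (T n zn)) : XiP -> borel 'rV[R]_m)] /\
     (* local boundedness *)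
     (forall zbar, An n zbar ->
        exists (rho : R) (c : Xi -> R),
          [/\ 0 < rho, (forall x, 0 <= c x),
              P.-integrable [set: XiP] (fun x : XiP => (c x)%:E) &
              {ae P, forall x : XiP,
                 forall zn, (ball2 zbar rho `&` An n) zn ->
                   `|G x (T n zn)| <= c x}]) /\
     (* approximation of the performance functions *)
     (exists eps : nat -> R,
        [/\ (forall nu, 0 <= eps nu), eps @ \oo --> (0 : R) &
            forall nu i u z, (Zn n `&` A) z ->
              `|gnu nu i (u, z) - g i (u, z)| <= eps nu]) /\
     (* solution properties and approximations *)
     (exists (eta kappa : R) (lam mu : Xi -> R) (rho pi_ : 'rV[R]_n.+1 -> R)
        (Delta0 : 'rV[R]_n.+1 -> R) (Delta : nat -> 'rV[R]_n.+1 -> R),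
        [/\ 0 < eta /\ 0 < kappa,
            (forall x, 0 <= lam x /\ 0 <= mu x),
            (forall zn, An n zn ->
               [/\ 0 < rho zn, 0 < pi_ zn, 0 <= Delta0 zn &
                   forall nu, 0 <= Delta nu zn]) &
            [/\ P.-integrable [set: XiP]
                  (fun x : XiP => (lam x `^ eta * mu x `^ kappa)%:E) /\
                P.-integrable [set: XiP] (fun x : XiP => (mu x `^ kappa)%:E),
                {ae P, forall x : XiP,
                   forall zn, An n zn -> forall u u' nu i,
                   [/\ `|g i (u, T n zn) - g i (u', T n zn)| <=
                         pi_ zn * (`|u| `^ eta + `|u'| `^ eta + 1)
                           * `|u - u'| `^ kappa,
                       Num.max `|s x (T n zn)| `|snu nu x (T n zn)| <=
                         lam x * Delta0 zn &
                       `|snu nu x (T n zn) - s x (T n zn)| <=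
                         mu x * Delta nu zn]} &
                forall zbar, An n zbar ->
                  let B := ball2 zbar (rho zbar) `&` An n in
                  [/\ (ereal_sup [set (pi_ zn)%:E | zn in B] < +oo)%E,
                      (ereal_sup [set (Delta0 zn)%:E | zn in B] < +oo)%E &
                      (fun nu => ereal_sup [set (Delta nu zn)%:E | zn in B])
                        @ \oo --> 0%E]]])) ->
  (* (a) *)
  ([/\ continuous h,
       (forall (wnu : nat -> 'rV[R]_m) (w : 'rV[R]_m), wnu @ \oo --> w ->
          (fun nu => hnu nu (wnu nu)) @ \oo --> h w /\ (-oo < h w)%E) &
       forall z, A z -> exists zs : nat -> Z,
         (forall n, (A `&` Zn n) (zs n)) /\ zs @ \oo --> z] \/
  (* (b) *)
   [/\ (forall (wnu : nat -> 'rV[R]_m) (w : 'rV[R]_m), wnu @ \oo --> w ->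
          (h w <= limn_einf (fun nu => hnu nu (wnu nu)))%E /\ (-oo < h w)%E),
       (forall nu w, (hnu nu w <= h w)%E),
       lower_semicontinuous h /\ (forall w w', lev w w' -> (h w <= h w')%E),
       (forall n, (nbar <= n)%N -> forall zn, An n zn ->
          (h (EG (T n zn)) < +oo)%E ->
          exists znu : nat -> 'rV[R]_n.+1,
            [/\ (forall nu, An n (znu nu)), znu @ \oo --> zn &
                forall nu, ltv (EG (T n (znu nu))) (EG (T n zn))]) &
       forall z, A z -> (h (EG z) < +oo)%E ->
         exists zs : nat -> Z,
           [/\ (forall n, (A `&` Zn n) (zs n)), zs @ \oo --> z &
               forall n, lev (EG (zs n)) (EG z)]]) ->
  {ae Pr, forall w : Omega, forall eps : R, 0 < eps ->
     exists neps : nat, (nbar <= neps)%N /\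
       forall n, (neps <= n)%N ->
       forall (delta_ : nat -> R) (delta : R)
              (zs : nat -> 'rV[R]_n.+1) (zbar : 'rV[R]_n.+1),
         (forall nu, 0 <= delta_ nu) -> 0 <= delta ->
         delta_ @ \oo --> delta ->
         (forall nu, delta_argmin (delta_ nu) (phinnu w n nu) (zs nu)) ->
         cluster (zs @ \oo) zbar ->
         (phi (T n zbar) <= ereal_inf (range phi) + (eps + delta)%:E)%E}.
Proof.
move=> XiP P G EG Gnu phi An phin phinnu iG infphi closedA /within_continuous_on cf.
move=> indxis idxis domZ cond modes.
have [PrC [iid aeC]] : exists PrC : probability (completion_type Pr) R,
    pairwise_iid P PrC xis /\
    forall Q : Omega -> Prop, {ae PrC, forall w : completion_type Pr, Q w} ->
      {ae Pr, forall w, Q w}.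
  exists (completion Pr); split; first exact: completion_pairwise_iid.
  by move=> Q; exact: ae_completion.
have [_ [[cs cg _ _] _]] := cond nbar (leqnn _).
pose H (i : 'I_m) (x : XiP) (z : Z) : R := G x z 0 i.
have HE i x z : H i x z = g i (s x z, z) by rewrite /H /G /performance mxE.
have cH i : {ae P, forall x, continuous (H i x)}.
  apply: filterS cs => x csx z.
  rewrite (_ : H i x = fun z => g i (s x z, z)); last exact/funext.
  have pair_cvg : (s x y, y) @[y --> z] --> (s x z, z).
    exact: (cvg_pair (csx z) cvg_id).
  exact: (cvg_comp _ _ pair_cvg (cg i _)).
have domH i z : A z -> exists (r : R) (c : XiP -> R),
  [/\ 0 < r, P.-integrable setT (EFin \o c) &
    {ae P, forall x, forall z', A z' -> `|z' - z| <= r -> `|H i x z'| <= c x}].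
  move=> Az; have [_ [r [c [r0 _ ic Hc]]]] := domZ z Az.
  exists r, c; split => //; apply: filterS Hc => x Hcx z' Az' z'z.
  exact: le_trans (row_entry_le _ _) (Hcx z' Az' z'z).
have iH i z : A z -> P.-integrable setT (EFin \o H i ^~ z) by move=> Az; exact: iG.
have EGE z i : EG z 0 i = \int[P]_x H i x z by rewrite /EG /expectation_vec mxE.
have EG_cvg z (zs : nat -> Z) : A z -> (forall n, A (zs n)) -> zs @ \oo --> z ->
    (fun n => EG (zs n)) @ \oo --> EG z.
  move=> Az Azs zsz; apply: cvg_row => i; rewrite EGE.
  rewrite (_ : (fun n => _) = fun n => \int[P]_x H i x (zs n)); last first.
    by apply/funext => n; rewrite EGE.
  exact: (expectation_continuous (iH i) (cH i) (domH i)).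
(* a constant sequence shows that h never takes the value -oo *)
have hNy v : (-oo < h v)%E.
  case: modes => [[_ /(_ (fun=> v) v (cvg_cst _))[]]|] //.
  by move=> [/(_ (fun=> v) v (cvg_cst _))[]].
have lower : lower_epi_limit hnu h.
  apply: liminf_lower_epi_limit => wnu v wv.
  case: modes => [[_ /(_ _ _ wv)[/cvg_limn_einf_sup[<-] _ _ _]]|[/(_ _ _ wv)[]]] //.
have disc eps : 0 < eps -> exists neps, (nbar <= neps)%N /\
    forall n, (neps <= n)%N -> exists zn : 'rV[R]_n.+1,
      (phi (T n zn) <= ereal_inf (range phi) + eps%:E)%E.
  move=> eps0; have [|lty] := eqVneq (ereal_inf (range phi)) +oo%E.
    by move=> ->; exists nbar; split => // n _; exists 0; rewrite addye// leey.
  have fin : ereal_inf (range phi) \is a fin_num by rewrite fin_numElt infphi ltey.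
  pose t := fine (ereal_inf (range phi)) + eps.
  have tE : (ereal_inf (range phi) + eps%:E = t%:E)%E by rewrite EFinD fineK.
  have : (ereal_inf (range phi) < t%:E)%E by rewrite -tE lteDl// lte_fin.
  move=> /ereal_inf_lt[_ [z _ <-] phizt].
  have [Az hz] := composite_objective_lty (lt_trans phizt (ltry t)).
  have [N HN] : exists N, forall n, (N <= n)%N -> exists2 y, Zn n y & (phi y < t%:E)%E.
    case: modes => [[hcont _ /(_ z Az)[zs [zsP zsz]]]|].
      apply: (@discretization_upper _ _ _ A f h EG Zn cf z t zs Az zsP zsz _ phizt).
      move=> v hv.
      have hEG := cvg_comp _ _ (EG_cvg z zs Az (fun n => (zsP n).1) zsz) (hcont (EG z)).
      exact: (hEG _ (open_ereal_lt' hv)).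
    move=> [_ _ [_ hmono] _ /(_ z Az hz)[zs [zsP zsz zsle]]].
    apply: (@discretization_upper _ _ _ A f h EG Zn cf z t zs Az zsP zsz _ phizt).
    move=> v hv.
    by apply: nearW => n; apply: le_lt_trans hv; exact: hmono.
  exists (maxn nbar N); split; first exact: leq_maxl.
  move=> n; rewrite geq_max => /andP[_ /HN[y]].
  by rewrite -hT => -[zn _ <-] /ltW yt; exists zn; rewrite tE.
have lln : {ae PrC, forall w : completion_type Pr, forall n, (nbar <= n)%N ->
    locally_uniform_cvg (An n)
      (fun nu zn => sample_mean (fun x => Gnu nu x (T n zn)) (fun j => xis j w) nu)
      (fun zn => EG (T n zn))}.
  have ulln : {ae PrC, forall w : completion_type Pr, forall i z, A z ->
      forall e : R, 0 < e ->
      exists2 r : R, 0 < r & exists N, forall nu, (N <= nu)%N -> forall z', A z' ->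
      `|z' - z| < r ->
      `|(\sum_(j < nu.+1) H i (xis j w) z') / nu.+1%:R - \int[P]_x H i x z| < e}.
    apply: filter_forall => i.
    exact: (uniform_lln iid sepZ (iH i) (cH i) (domH i)).
  have close : {ae PrC, forall w : completion_type Pr, forall n, (nbar <= n)%N ->
      forall y0, An n y0 ->
      forall e : R, 0 < e -> exists2 r : R, 0 < r & exists N, forall nu, (N <= nu)%N ->
      forall y, An n y -> `|y - y0| < r -> forall i,
      `|(\sum_(j < nu.+1) Gnu nu (xis j w) (T n y) 0 i) / nu.+1%:R -
        (\sum_(j < nu.+1) H i (xis j w) (T n y)) / nu.+1%:R| < e}.
    apply: ae_foralln => n.
    have [nn|nn] := boolP (nbar <= n)%N; last by apply: aeW => w.
    have [_ [_ [_ [[eps [eps0 epscvg epsg]] sol]]]] := cond n nn.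
    have [eta [kappa [lam [mu [rho [p [D0 [D [[eta0 kappa0] lammu pos
      [[iL iM] bounds sups]]]]]]]]]] := sol.
    apply: filterS3 (ae_iid iid bounds) (slln iid iL) (slln iid iM).
    move=> w wb cL cM _ y0 Ay0.
    have [rho0 _ _ _] := pos y0 Ay0; have [s1 s2 s3] := sups y0 Ay0.
    apply: (@sample_means_close _ _ _ _ (fun j => xis j w) (An n) y0
      (fun i x y => H i x (T n y)) (fun nu i x y => Gnu nu x (T n y) 0 i)
      eps p D0 D (fun x => lam x `^ eta * mu x `^ kappa) (fun x => mu x `^ kappa)
      eta kappa (rho y0) _ _ kappa0 eta0 rho0 epscvg _ _ _ _ cL cM s1 s2 s3).
    - by move=> x; rewrite mulr_ge0 ?powR_ge0.
    - by move=> x; exact: powR_ge0.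
    - by move=> y Ay; have [_ p0 D00 Dn] := pos y Ay; split => //; exact: ltW.
    move=> j nu i y Ay; have [_ p0 D00 Dn] := pos y Ay.
    have [lam0 mu0] := lammu (xis j w).
    have [gap smax sgap] :=
      wb j y Ay (snu nu (xis j w) (T n y)) (s (xis j w) (T n y)) nu i.
    rewrite HE /Gnu /performance mxE.
    apply: (performance_gap eta0 kappa0 (ltW p0) lam0 mu0 D00 (Dn nu)
      _ _ _ _ gap smax sgap) => //.
    by apply: epsg; rewrite -hT; split => //; exists y.
  apply: filterS2 ulln close => w uw cw n nn y0 Ay0 e e0.
  have [_ [[_ _ cT _] _]] := cond n nn.
  have e2 : 0 < e / 2 by rewrite divr_gt0.
  have [r2 r20 [N2 HN2]] := cw n nn y0 Ay0 _ e2.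
  (* the radii and ranks of the m components are combined by a minimum and a maximum *)
  have /choice[r1 rP1] (i : 'I_m) : exists k : R * nat, 0 < k.1 /\
      forall nu, (k.2 <= nu)%N -> forall z', A z' -> `|z' - T n y0| < k.1 ->
      `|(\sum_(j < nu.+1) H i (xis j w) z') / nu.+1%:R - EG (T n y0) 0 i| < e / 2.
    have [r r0 [N HN]] := uw i (T n y0) Ay0 _ e2.
    by exists (r, N); split => //; rewrite EGE.
  pose r := \big[Num.min/1]_i (r1 i).1.
  have r0 : 0 < r by apply: lt_bigmin => // i _; case: (rP1 i).
  have /cvgrPdist_lt/(_ r r0)/nbhs_ballP[r3 /= r30 rT] := cT y0.
  exists (Num.min r2 r3); first by rewrite lt_min r20.
  exists (maxn N2 (\max_i (r1 i).2)) => nu; rewrite geq_max => /andP[nu2 nu1] y Ay.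
  rewrite lt_min => /andP[yr2 yr3]; apply: row_norm_lt => // i.
  have Tyr : `|T n y - T n y0| < (r1 i).1.
    have : `|T n y0 - T n y| < r.
      by apply: rT; rewrite -ball_normE /= distrC.
    by rewrite distrC => /lt_le_trans; apply; exact: bigmin_le.
  have nui : ((r1 i).2 <= nu)%N by rewrite (leq_trans _ nu1)// (leq_bigmax i).
  have [_ h1] := rP1 i; have := h1 nu nui (T n y) Ay Tyr.
  have := HN2 nu nu2 y Ay yr2 i => h2 h3.
  have -> : (sample_mean (fun x => Gnu nu x (T n y)) (fun j => xis j w) nu -
      EG (T n y0)) 0 i =
      (\sum_(j < nu.+1) Gnu nu (xis j w) (T n y) 0 i) / nu.+1%:R - EG (T n y0) 0 i.
    by rewrite /sample_mean !mxE summxE mulrC.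
  by rewrite (splitr e) (le_lt_trans (ler_distD _ _ _) (ltrD h2 h3)).
apply: aeC; apply: filterS lln => w lln eps eps0.
have [neps [nneps discn]] := disc eps eps0.
exists neps; split => // n len delta_ delta zs zbar _ delta0 dcvg zsP clz.
have nbn : (nbar <= n)%N := leq_trans nneps len.
have [_ [[_ _ cT _] _]] := cond n nbn.
have [zn phizn] := discn n len.
have cfT : continuous_on (An n) (f \o T n) by exact: continuous_on_comp.
have closedAn : closed (An n).
  by apply: closed_comp closedA => // y _; exact: cT.
have upper : upper_approximable (An n) (f \o T n) h hnu (fun zn => EG (T n zn))
    (fun nu zn => sample_mean (fun x => Gnu nu x (T n zn)) (fun j => xis j w) nu).
  case: modes => [[_ hcvg _]|[_ hle [_ hmono] slater _]].
    apply: upper_approximable_cvg (lln n nbn) _ => vnu v vv.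
    by have [] := hcvg _ _ vv.
  exact: (upper_approximable_monotone cfT (lln n nbn) hle hmono (slater n nbn)).
have := cluster_near_optimal closedAn cfT (lln n nbn) lower upper hNy dcvg zsP clz zn.
move=> /le_trans; apply; rewrite EFinD addeA leeD2r//.
Qed.
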